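(* Suppose Assumption 1 holds, and let $\Gamma$ be a $T\times T$ matrix measurable with respect to $\tilde X$ with $\|\Gamma\|<1-c$. Then $$\frac{\hat\sigma^2(\Gamma)}{\sigma^2}=1-\frac{\sigma^2\,\alpha'\bar S_\Gamma^{-1}\alpha}{T-K_\Gamma}\operatorname{tr}\big[D'(I_T-\Gamma)\tilde M_\Gamma\big]\operatorname{tr}\big[D(I_T-\Gamma)\tilde M_\Gamma\big]+o_p(1),$$ where $\bar S_\Gamma=\tilde X'(I_T-\Gamma)\tilde X+\sigma^2\alpha\alpha'\operatorname{tr}[(I_T-\Gamma)\tilde M_\Gamma]$. In particular, if $\operatorname{tr}[D'(I_T-\Gamma)\tilde M_\Gamma]=0$ then $\hat\sigma^2(\Gamma)\xrightarrow{p}\sigma^2$ (i.e. $\hat\sigma^2(\Gamma)/\sigma^2=1+o_p(1)$).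
   Context: Asymptotic framework: all objects may depend on the sample size $T$; limits, $O_p$ and $o_p$ are as $T\to\infty$; $c\in(0,1)$ and $C>0$ denote fixed constants not depending on $T$. Model: $y_t=x_t'\beta+\varepsilon_t$, $t=1,\dots,T$, with $x_t,\beta\in\mathbb R^K$; $y=(y_1,\dots,y_T)'$, $X=[x_1,\dots,x_T]'$ ($T\times K$), $\varepsilon=(\varepsilon_1,\dots,\varepsilon_T)'$. Assumption 1: (i) $x_t=\tilde x_t+\alpha\varepsilon_{t-1}$ for all $t$, where $\tilde X=[\tilde x_1,\dots,\tilde x_T]'$ is $T\times K$ of full column rank $K$; (ii) $\{\varepsilon_t\}_{t=0}^T$ are i.i.d. conditionally on $\tilde X$ with $E[\varepsilon_t\mid\tilde X]=0$, $c<\sigma^2:=E[\varepsilon_t^2\mid\tilde X]<C$ and $E[\varepsilon_t^4\mid\tilde X]<C$ almost surely; (iii) $\alpha,r\in\mathbb R^K$ are non-random with $\alpha'(\tfrac1T\tilde X'\tilde X)^{-1}\alpha=O_p(1)$ and $r'(\tfrac1T\tilde X'\tilde X)^{-1}r=O_p(1)$; (iv) $K$ may diverge with $T$ and $K/T<1-c$. Notation: $\|\cdot\|$ is the operator norm. $D$ is the $T\times T$ lag matrix whose only nonzero entries are $D_{t,t-1}=1$, $t=2,\dots,T$. For a $T\times T$ matrix $\Gamma$: $\tilde M_\Gamma=I_T-\tilde X(\tilde X'(I_T-\Gamma)\tilde X)^{-1}\tilde X'(I_T-\Gamma)$; $M_\Gamma=I_T-X(X'(I_T-\Gamma)X)^{-1}X'(I_T-\Gamma)$;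 $T-K_\Gamma:=\operatorname{tr}[(I_T-\Gamma)\tilde M_\Gamma]$; $\hat\sigma^2(\Gamma)=\frac{y'(I_T-\Gamma)M_\Gamma y}{T-K_\Gamma}$. *)

(* Defs.v *)
From HB Require Import structures.
From mathcomp Require Import all_boot all_order all_algebra.
From mathcomp Require Import all_classical all_reals all_analysis.
Set Implicit Arguments. Unset Strict Implicit. Unset Printing Implicit Defensive.
Import Order.TTheory GRing.Theory Num.Theory.
Local Open Scope classical_set_scope.
Local Open Scope ring_scope.

Section Linalg.
Variable R : realType.

Definition vnorm n (v : 'cV[R]_n) : R := Num.sqrt (\sum_i (v i 0) ^+ 2).

Definition opnorm n (G : 'M[R]_n) : R :=
  sup [set vnorm (G *m v) | v in [set v : 'cV[R]_n | vnorm v = 1]].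

Definition lagD n : 'M[R]_n := \matrix_(i, j) (((i : nat) == (j : nat).+1)%:R).

Definition MG n k (X : 'M[R]_(n, k)) (G : 'M[R]_n) : 'M[R]_n :=
  1%:M - X *m invmx (X^T *m (1%:M - G) *m X) *m X^T *m (1%:M - G).

Definition TmK n k (Xt : 'M[R]_(n, k)) (G : 'M[R]_n) : R :=
  \tr ((1%:M - G) *m MG Xt G).

Definition sigma_hat n k (Xt X : 'M[R]_(n, k)) (y : 'cV[R]_n) (G : 'M[R]_n) : R :=
  (y^T *m (1%:M - G) *m MG X G *m y) 0 0 / TmK Xt G.

Definition Sbar n k (Xt : 'M[R]_(n, k)) (G : 'M[R]_n) (alpha : 'cV[R]_k) (s2 : R)
  : 'M[R]_k :=
  Xt^T *m (1%:M - G) *m Xt + (s2 * TmK Xt G) *: (alpha *m alpha^T).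

Definition rhs_limit n k (Xt : 'M[R]_(n, k)) (G : 'M[R]_n) (alpha : 'cV[R]_k) (s2 : R) : R :=
  1 - (s2 * (alpha^T *m invmx (Sbar Xt G alpha s2) *m alpha) 0 0 / TmK Xt G)
      * \tr ((lagD n)^T *m (1%:M - G) *m MG Xt G)
      * \tr (lagD n *m (1%:M - G) *m MG Xt G).

End Linalg.

Section Prob.
Variable R : realType.

Definition sigma_gen d (Omega : measurableType d) m k (X : Omega -> 'M[R]_(m, k))
  : set (set Omega) :=
  <<s [set A | exists i j (B : set R), measurable B /\ A = (fun w => X w i j) @^-1` B] >>.

Definition measurable_wrt d (Omega : measurableType d) (G : set (set Omega)) (Z : Omega -> R) :=
  forall B : set R, measurable B -> G (Z @^-1` B).

(* the family (e i)_{i < N} is i.i.d. conditionally on the sigma-algebra G, with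
   (regular) conditional distribution mu : Omega -> probability R R *)
Definition cond_iid d (Omega : measurableType d) (P : probability Omega R)
  (G : set (set Omega)) N (e : 'I_N -> Omega -> R) (mu : Omega -> probability R R) :=
  (forall A : set R, measurable A -> measurable_wrt G (fun w => fine (mu w A))) /\
  (forall H : set Omega, G H -> forall A : 'I_N -> set R, (forall i, measurable (A i)) ->
     P (H `&` \bigcap_(i in setT) (e i @^-1` A i))
     = (\int[P]_(w in H) (\prod_(i < N) fine (mu w (A i)))%:E)%E).

Definition Op1 (d : nat -> measure_display) (Omega : forall T, measurableType (d T))
  (P : forall T, probability (Omega T) R) (Z : forall T, Omega T -> R) :=
  forall eps : R, 0 < eps -> exists (M : R) (N : nat), forall T, (N <= T)%N ->
    (P T [set w | (M < `|Z T w|)%R] < eps%:E)%E.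

Definition op1 (d : nat -> measure_display) (Omega : forall T, measurableType (d T))
  (P : forall T, probability (Omega T) R) (Z : forall T, Omega T -> R) :=
  forall eps delta : R, 0 < eps -> 0 < delta -> exists N : nat, forall T, (N <= T)%N ->
    (P T [set w | (eps < `|Z T w|)%R] < delta%:E)%E.

End Prob.

Section Model.
Variable R : realType.

(* regressors x_t = tilde x_t + alpha eps_{t-1}, t = 1..T (row i <-> t = i+1,
   eps indexed 0..T) *)
Definition model_X n k (Xt : 'M[R]_(n, k)) (e : 'I_n.+1 -> R) (alpha : 'cV[R]_k)
  : 'M[R]_(n, k) :=
  Xt + (\col_i e (widen_ord (leqnSn n) i)) *m alpha^T.

Definition model_y n k (Xt : 'M[R]_(n, k)) (e : 'I_n.+1 -> R) (alpha beta : 'cV[R]_k)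
  : 'cV[R]_n :=
  model_X Xt e alpha *m beta + \col_i e (lift ord0 i).

(* sigma^2 = E[eps_t^2 | tilde X], computed from the conditional law mu *)
Definition cond_var (mu : probability R R) : R :=
  fine (\int[mu]_y (y ^+ 2)%:E)%E.

End Model.

(* Main.v *)
Require Import Defs.
From HB Require Import structures.
From mathcomp Require Import all_boot all_order all_algebra.
From mathcomp Require Import all_classical all_reals all_analysis.
From mathcomp Require Import measurable_realfun ring lra.
(** Put Q = 1 - Gamma, A = Q M~_Gamma, S = X~'QX~, s = a'S^-1 a, g = QX~S^-1 a and
    h = Q'X~S'^-1 a, where a is alpha, e is the current and l the lagged error
    vector.  Since X = X~ + l a', the normal equations for X differ from those for
    X~ only through two scalars, and
    y'QM_Gamma y = e'Ae - tau e'Al - rho e'g, where tau and rho are quotients with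
    denominator (1 + l'g)(1 + h'l) + s l'Al.  Conditionally on X~ the quadratic forms
    in e and l concentrate around sigma^2 times the corresponding traces, with
    variance at most (2C^2 + C)|A|_F^2 = O(T), and the linear forms l'g, h'l, h'e,
    e'g have second moments O(1/T), because |g|^2 and |h|^2 are controlled by
    a'(X~'X~)^-1 a = O_p(1/T).  Replacing the forms by their limits gives the formula,
    Sherman-Morrison turning s/(1 + s sigma^2 tr A) into a'Sbar^-1 a.  The denominator
    T - K_Gamma = tr A is of order T: A = M~'QM~ with Q coercive and M~ idempotent. *)

Set Implicit Arguments.
Unset Strict Implicit.
Unset Printing Implicit Defensive.
Import Order.TTheory GRing.Theory Num.Theory.
Import numFieldNormedType.Exports.
Local Open Scope classical_set_scope.
Local Open Scope ring_scope.

(** * Positive functionals and integration *)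

(** No conditional expectation is formed. The hypothesis [cond_iid] is turned into the identity
    E[W prod_i f_i(eps_i)] = E[W prod_i mu(f_i)] for weights W that depend on X~ only. The indicator
    of an X~-measurable event is such a weight, so conditional variance bounds become ordinary
    Chebyshev bounds restricted to that event. Hence all that is needed of X~, Gamma and mu is
    collected in one X~-measurable event, and the probability of its complement is left to the
    O_p(1) hypothesis on alpha. Constants are fixed in the order M (the level in that hypothesis),
    accuracy delta, sample size T: the Chebyshev bounds are O(1/T) with factors that depend on M and
    delta. Gamma is not symmetric. This is why g and h are different vectors, why the two lag traces
    may differ and why bounds on Q are transferred to Q'. M~ is an oblique projection, so its norm
    is controlled only through the coercivity of Q. *)

Section PositiveFunctionals.
Local Open Scope ereal_scope.
Context {d} {T : measurableType d} {R : realType}.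
Implicit Types (f g : T -> \bar R) (L : (T -> \bar R) -> \bar R).

Definition nnmfun f := (forall x, 0 <= f x) /\ measurable_fun [set: T] f.

(** The closure properties of an integral that extend an identity from indicators to nonnegative
    functions. They are stated abstractly because they will be applied to mixed functionals, which
    integrate first against a kernel and then against a measure. *)
Definition positive_functional L := [/\
  forall f g, nnmfun f -> nnmfun g -> L (fun x => f x + g x) = L f + L g,
  forall (r : R) f, (0 <= r)%R -> nnmfun f -> L (fun x => r%:E * f x) = r%:E * L f &
  forall g : nat -> T -> \bar R, (forall n, nnmfun (g n)) ->
    (forall x, {homo g^~ x : n m / (n <= m)%N >-> n <= m}) ->
    L (fun x => limn (g^~ x)) = limn (fun n => L (g n))].

Lemma nnmfun_indic (A : set T) : measurable A -> nnmfun (fun x => (\1_A x)%:E).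
Proof.
move=> mA; split; first by move=> x; rewrite lee_fin.
by apply/measurable_EFinP; exact: measurable_indic.
Qed.

Lemma nnmfunZ (r : R) f : (0 <= r)%R -> nnmfun f -> nnmfun (fun x => r%:E * f x).
Proof.
move=> r0 [f0 mf]; split; first by move=> x; rewrite mule_ge0// lee_fin.
exact: measurable_funeM.
Qed.

Lemma nnmfunD f g : nnmfun f -> nnmfun g -> nnmfun (fun x => f x + g x).
Proof.
move=> [f0 mf] [g0 mg]; split; first by move=> x; rewrite adde_ge0.
exact: emeasurable_funD.
Qed.

Lemma nnmfunM f g : nnmfun f -> nnmfun g -> nnmfun (fun x => f x * g x).
Proof.
move=> [f0 mf] [g0 mg]; split; first by move=> x; rewrite mule_ge0.
exact: emeasurable_funM.
Qed.

Lemma nnmfun_cst (c : \bar R) : 0 <= c -> nnmfun (fun=> c).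
Proof. by move=> c0; split => //; exact: measurable_cst. Qed.

Lemma nnmfun_sum (I : Type) (s : seq I) (F : I -> T -> \bar R) :
  (forall i, nnmfun (F i)) -> nnmfun (fun x => \sum_(i <- s) F i x).
Proof.
move=> hF; elim: s => [|i s IH].
  by under eq_fun do rewrite big_nil; exact: nnmfun_cst.
by under eq_fun do rewrite big_cons; exact: nnmfunD.
Qed.

Lemma nnmfun_prod (I : Type) (s : seq I) (Q : pred I) (F : I -> T -> \bar R) :
  (forall i, Q i -> nnmfun (F i)) -> nnmfun (fun x => \big[mule/1]_(i <- s | Q i) F i x).
Proof.
move=> hF; elim: s => [|i s IH].
  by under eq_fun do rewrite big_nil; exact: nnmfun_cst.
have [Qi|nQi] := boolP (Q i); last by under eq_fun do rewrite big_cons (negbTE nQi).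
under eq_fun do rewrite big_cons Qi.
by apply: nnmfunM => //; exact: hF.
Qed.

Lemma positive_functional_sum L (I : Type) (s : seq I) (F : I -> T -> \bar R) :
  positive_functional L -> (forall i, nnmfun (F i)) ->
  L (fun x => \sum_(i <- s) F i x) = \sum_(i <- s) L (F i).
Proof.
move=> [LD LZ _] hF; elim: s => [|i s IH].
  (* Additivity alone leaves infinity as a possible value at the zero function; homogeneity with
     factor 0 excludes it. *)
  rewrite big_nil; have := LZ 0%R (fun=> 0) (lexx 0%R) (nnmfun_cst (lexx 0)).
  rewrite (mul0e (L _)) => E; rewrite -[RHS]E.
  by congr L; apply/funext => x; rewrite big_nil mul0e.
rewrite big_cons -IH -LD//; last exact: nnmfun_sum.
by congr L; apply/funext => x; rewrite big_cons.
Qed.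

Import HBNNSimple.

(** Linearity passes from indicators to simple functions, and monotone limits from these to all
    nonnegative measurable functions. The factorization over the errors is proved with it, one
    argument at a time. *)
Lemma positive_functional_ext L1 L2 :
  positive_functional L1 -> positive_functional L2 ->
  (forall A, measurable A -> L1 (fun x => (\1_A x)%:E) = L2 (fun x => (\1_A x)%:E)) ->
  forall f, nnmfun f -> L1 f = L2 f.
Proof.
move=> p1 p2 L12 f [f0 mf].
have simple (h : {nnsfun T >-> R}) : L1 (EFin \o h) = L2 (EFin \o h).
  have -> : EFin \o h = fun x => \sum_(i < size (finmap.enum_fset (fset_set (range h))))
     (fun i x => ((finmap.enum_fset (fset_set (range h)))`_i)%:E *
       (\1_(h @^-1` [set (finmap.enum_fset (fset_set (range h)))`_i]) x)%:E) i x.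
    apply/funext => x /=; rewrite {1}fimfunEord -sumEFin.
    by apply: eq_bigr => i _; rewrite EFinM.
  have s0 (i : 'I_(size (finmap.enum_fset (fset_set (range h))))) :
      (0 <= (finmap.enum_fset (fset_set (range h)))`_i)%R.
    have := mem_nth 0%R (ltn_ord i); rewrite in_fset_set//.
    by rewrite inE => -[x _ <-].
  have nh (i : 'I_(size (finmap.enum_fset (fset_set (range h))))) :
     nnmfun (fun x => (\1_(h @^-1` [set (finmap.enum_fset (fset_set (range h)))`_i]) x)%:E).
    exact: nnmfun_indic.
  rewrite !positive_functional_sum//; try by move=> i; exact: nnmfunZ.
  apply: eq_bigr => i _.
  case: p1 => _ -> //; case: p2 => _ -> //.
  by rewrite L12.
pose f_ := nnsfun_approx measurableT mf.
have -> : f = fun x => limn (fun n => (f_ n x)%:E).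
  by apply/funext => x; apply/esym/cvg_lim => //; exact: cvg_nnsfun_approx.
have nf n : nnmfun (fun x => (f_ n x)%:E).
  by split=> [x|]; [rewrite lee_fin | exact/measurable_EFinP].
have hf x : {homo (fun n => (f_ n x)%:E) : n m / (n <= m)%N >-> n <= m}.
  by move=> a b ab; rewrite lee_fin; exact/lefP/nd_nnsfun_approx.
case: (p1) => _ _ ->//; case: (p2) => _ _ ->//.
by congr (limn _); apply/funext => n; exact: simple.
Qed.

End PositiveFunctionals.

(** Multiplication is discontinuous at 0 times infinity. The exceptional cases are harmless: if v =
    0 all products are 0, and if the limit is 0 then a nondecreasing nonnegative sequence is
    identically 0. *)
Lemma lim_mule_nd {R : realType} (v : \bar R) (u : nat -> \bar R) :
  (0 <= v)%E -> (forall n, 0 <= u n)%E -> {homo u : n m / (n <= m)%N >-> (n <= m)%E} ->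
  (limn (fun n => v * u n) = v * limn u)%E.
Proof.
move=> v0 u0 nd.
have cu : cvgn u by exact: ereal_nondecreasing_is_cvgn.
have [->|vn0] := eqVneq v 0%E.
  rewrite mul0e; apply/cvg_lim => //; under eq_fun do rewrite mul0e; exact: cvg_cst.
have [l0|ln0] := eqVneq (limn u) 0%E.
  rewrite l0 mule0; have u00 n : u n = 0%E.
    apply/eqP; rewrite eq_le u0 andbT -[leRHS]l0.
    have -> : limn u = ereal_sup (range u).
      by apply/cvg_lim => //; exact: ereal_nondecreasing_cvgn.
    by apply: ereal_sup_ubound; exists n.
  by apply/cvg_lim => //; under eq_fun do rewrite u00 mule0; exact: cvg_cst.
apply/cvg_lim => //; apply: (@cvgeM _ _ _ _ (fun=> v)) => //; last exact: cvg_cst.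
by rewrite mule_defE negb_or !negb_and vn0 ln0.
Qed.

Section IntegralFunctionals.
Local Open Scope ereal_scope.
Context {d d'} {T : measurableType d} {U : measurableType d'} {R : realType}.
Variable P : {measure set T -> \bar R}.

Lemma nnmfun_comp (V : T -> U) (f : U -> \bar R) :
  measurable_fun setT V -> nnmfun f -> nnmfun (f \o V).
Proof. by move=> mV [f0 mf]; split=> [x|]; [exact: f0|exact: measurableT_comp]. Qed.

(** The weight V holds the factors that stay fixed; K f t is f at a random point in one application
    and the integral of f against the kernel at t in another. These are the two sides of the
    factorization to be proved. *)
Lemma positive_functional_weight (V : T -> \bar R) (K : (U -> \bar R) -> T -> \bar R) :
  nnmfun V -> (forall f, nnmfun f -> nnmfun (K f)) ->
  (forall t, positive_functional (K^~ t)) ->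
  (forall t f g, nnmfun f -> nnmfun g -> (forall x, f x <= g x) -> K f t <= K g t) ->
  positive_functional (fun f => \int[P]_t (V t * K f t)).
Proof.
move=> nV nK pK mK; split.
- move=> f g nf ng; rewrite -ge0_integralD//.
  + apply: eq_integral => t _; case: (pK t) => -> // _ _.
    by rewrite ge0_muleDr //; [exact: (nK _ nf).1|exact: (nK _ ng).1].
  + by move=> t _; exact: (nnmfunM nV (nK _ nf)).1.
  + exact: (nnmfunM nV (nK _ nf)).2.
  + by move=> t _; exact: (nnmfunM nV (nK _ ng)).1.
  + exact: (nnmfunM nV (nK _ ng)).2.
- move=> r f r0 nf; rewrite -ge0_integralZl_EFin//.
  + by apply: eq_integral => t _; case: (pK t) => _ -> // _; rewrite muleCA.
  + by move=> t _; exact: (nnmfunM nV (nK _ nf)).1.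
  + exact: (nnmfunM nV (nK _ nf)).2.
- move=> g ng hg.
  have nlim : forall t, {homo (fun n => K (g n) t) : n m / (n <= m)%N >-> n <= m}.
    by move=> t n m nm; apply: mK => // x; exact: hg.
  rewrite -monotone_convergence//.
  + apply: eq_integral => t _; case: (pK t) => _ _ -> //.
    apply/esym; apply: lim_mule_nd => [||n m nm]; [exact: nV.1| |exact: nlim].
    by move=> n; exact: (nK _ (ng n)).1.
  + by move=> n; exact: (nnmfunM nV (nK _ (ng n))).2.
  + by move=> n t _; exact: (nnmfunM nV (nK _ (ng n))).1.
  + by move=> t _ n m nm; apply: lee_wpmul2l; [exact: nV.1|exact: nlim].
Qed.
End IntegralFunctionals.

Section IntegralLemmas.
Local Open Scope ereal_scope.
Context {d} {T : measurableType d} {R : realType}.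

Lemma integral_lin (m : {measure set T -> \bar R}) (I : finType) (c : I -> R) (X : I -> T -> R) :
  (forall i, m.-integrable setT (EFin \o X i)) ->
  \int[m]_w (\sum_i c i * X i w)%:E = \sum_i (c i)%:E * \int[m]_w (X i w)%:E.
Proof.
move=> iX; under eq_integral do rewrite -sumEFin.
rewrite integral_sum//.
  by apply: eq_bigr => i _; under eq_integral do rewrite EFinM; rewrite integralZl//; exact: iX.
move=> i; under eq_fun do rewrite EFinM.
by apply: integrableZl => //; exact: iX.
Qed.

Lemma integrable_bounded (P : probability T R) (X : T -> R) (B : R) :
  measurable_fun [set: T] X -> (forall w, `|X w| <= B)%R ->
  P.-integrable setT (EFin \o X).
Proof.
move=> mX XB; apply/integrableP; split; first exact/measurable_EFinP.
apply: (@le_lt_trans _ _ (\int[P]_w B%:E)); last first.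
  rewrite integral_cst//; set p := (X in _ * X).
    by rewrite (_ : p = 1) ?mule1 ?ltry//; exact: probability_setT.
apply: ge0_le_integral => //.
- by apply/measurable_EFinP; exact: measurableT_comp.
- by move=> w _; rewrite (le_trans _ (_ : `|X w|%:E <= _))// lee_fin.
Qed.

End IntegralLemmas.

Section SameMean.
Context {d} {T : measurableType d} {R : realType}.
Variable P : {measure set T -> \bar R}.
Implicit Types X Z : T -> R.

(** Integrability of both sides travels with the equality, so that such relations can be added and
    negated without meeting infinity minus infinity. *)
Definition same_mean X Z := [/\ P.-integrable setT (EFin \o X),
  P.-integrable setT (EFin \o Z) & (\int[P]_w (X w)%:E = \int[P]_w (Z w)%:E)%E].

Lemma same_meanD X1 X2 Z1 Z2 : same_mean X1 Z1 -> same_mean X2 Z2 ->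
  same_mean (fun w => X1 w + X2 w) (fun w => Z1 w + Z2 w).
Proof.
move=> [iX1 iZ1 e1] [iX2 iZ2 e2]; split.
- by apply: eq_integrable (integrableD measurableT iX1 iX2) => // w _; rewrite /= EFinD.
- by apply: eq_integrable (integrableD measurableT iZ1 iZ2) => // w _; rewrite /= EFinD.
- under eq_integral do rewrite EFinD.
  under [RHS]eq_integral do rewrite EFinD.
  by rewrite !integralD// e1 e2.
Qed.

Lemma same_meanN X Z : same_mean X Z -> same_mean (fun w => - X w) (fun w => - Z w).
Proof.
move=> [iX iZ e]; split.
- by apply: eq_integrable (integrableN iX) => // w _; rewrite /= EFinN.
- by apply: eq_integrable (integrableN iZ) => // w _; rewrite /= EFinN.
- under eq_integral do rewrite EFinN -mulN1e.
  under [RHS]eq_integral do rewrite EFinN -mulN1e.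
  by rewrite !(integralZl measurableT)// e.
Qed.

Lemma same_mean_sum (I : finType) (X Z : I -> T -> R) :
  (forall i, same_mean (X i) (Z i)) ->
  same_mean (fun w => \sum_i X i w) (fun w => \sum_i Z i w).
Proof.
move=> h; rewrite /index_enum; elim: (Finite.enum I) => [|i s IH].
  have i0 : P.-integrable setT (EFin \o (fun=> 0 : R)) by exact: integrable0.
  split.
  - by apply: eq_integrable i0 => // w _; rewrite /= big_nil.
  - by apply: eq_integrable i0 => // w _; rewrite /= big_nil.
  - by apply: eq_integral => w _; rewrite !big_nil.
have := same_meanD (h i) IH.
by congr same_mean; apply/funext => w; rewrite big_cons.
Qed.

(** The indicator inside the second moment lets v be a bound that is available on A only. *)
Lemma chebyshev_on (A : set T) (X : T -> R) (v t : R) : 0 < t -> measurable A ->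
  measurable_fun [set: T] X ->
  (\int[P]_w (\1_A w * (X w) ^+ 2)%:E <= v%:E)%E ->
  (P (A `&` [set w | (t < `|X w|)%R]) <= (v / t ^+ 2)%:E)%E.
Proof.
move=> t0 mA mX Xv.
have mB : measurable (A `&` [set w | (t < `|X w|)%R]).
  apply: measurableI => //.
  have mX' : measurable_fun [set: T] (fun w => `|X w|%R) by exact: measurableT_comp.
  have := mX' measurableT _ (measurable_itv `]t, +oo[).
  by rewrite setTI; congr measurable; apply/seteqP; split=> w /=; rewrite in_itv/= andbT.
have t2 : 0 < t ^+ 2 by rewrite exprn_gt0.
rewrite EFinM lee_pdivlMr// muleC.
apply: le_trans Xv.
have -> : P (A `&` [set w | (t < `|X w|)%R]) =
    (\int[P]_w (\1_(A `&` [set w | (t < `|X w|)%R]) w)%:E)%E by rewrite integral_indic// setIT.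
rewrite -ge0_integralZl_EFin//; last 2 first.
- by apply/measurable_EFinP; exact: measurable_indic.
- exact: ltW.
apply: ge0_le_integral => //.
- by move=> w _; rewrite -EFinM lee_fin mulr_ge0// ltW.
- by apply: measurable_funeM; apply/measurable_EFinP; exact: measurable_indic.
- apply/measurable_EFinP; apply: measurable_funM; first exact: measurable_indic.
  exact: measurable_funX.
- move=> w _; rewrite -EFinM lee_fin indicI /=.
  rewrite mulrCA; apply: ler_wpM2l => //.
  have [/set_mem /= tX|nt] := boolP (w \in [set w | (t < `|X w|)%R]).
    rewrite indicE mem_set// mulr1 -[leRHS]real_normK ?num_real// lerXn2r ?nnegrE ?(ltW t0)//.
    exact: ltW.
  by rewrite indicE (negbTE nt) mulr0 sqr_ge0.
Qed.

End SameMean.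
(** * Fourth moments *)

Section FourthMomentCombinatorics.
Context {R : comNzRingType} {N : nat}.
Variable m : nat -> R.
Hypotheses (m0 : m 0 = 1) (m1 : m 1 = 0).

Lemma prod_moment2 (a b : 'I_N) :
  \prod_i m ((i == a) + (i == b)) = (a == b)%:R * m 2.
Proof.
have [->|ab] := eqVneq a b.
  rewrite mul1r (bigD1 b)//= eqxx big1 ?mulr1// => i ib.
  by rewrite (negbTE ib).
by rewrite mul0r (bigD1 a)//= eqxx (negbTE ab) m1 mul0r.
Qed.

Lemma prod_moment_pair (a b : 'I_N) (p q : nat) : a != b ->
  \prod_i m ((i == a) * p + (i == b) * q) = m p * m q.
Proof.
move=> ab; rewrite (bigD1 a)//= (bigD1 b)/=; last by rewrite eq_sym.
rewrite !eqxx (negbTE ab) eq_sym (negbTE ab) !mul1n !mul0n addn0 add0n.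
by rewrite big1 ?mulr1// => i /andP[/negbTE -> /negbTE ->].
Qed.

(** The exponents count repetitions of an index, so for independent centred variables with moments m
    the left side is the mean of e_a e_b e_c e_d. An index that occurs exactly once annihilates it;
    what survives are the three pairings, corrected by the fourth cumulant when all four indices
    agree. *)
Lemma prod_moment4 (a b c d : 'I_N) :
  \prod_i m ((i == a) + (i == b) + (i == c) + (i == d)) =
  m 2 ^+ 2 * ((a == b)%:R * (c == d)%:R + (a == c)%:R * (b == d)%:R
              + (a == d)%:R * (b == c)%:R)
  + (m 4 - 3%:R * m 2 ^+ 2) * ((a == b)%:R * (a == c)%:R * (a == d)%:R).
Proof.
have once (u : 'I_N) (p : 'I_N -> nat) : p u = 1%N -> \prod_i m (p i) = 0.
  by move=> pu; rewrite (bigD1 u)//= pu m1 mul0r.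
have pair (u v : 'I_N) (p : 'I_N -> nat) : u != v ->
    (forall i, p i = (i == u) * 2 + (i == v) * 2)%N -> \prod_i m (p i) = m 2 ^+ 2.
  by move=> uv hp; rewrite expr2 -(prod_moment_pair 2 2 uv); apply: eq_bigr => i _; rewrite hp.
have [<-|ab] := eqVneq a b.
  have [<-|ac] := eqVneq a c.
    have [<-|ad] := eqVneq a d.
      rewrite (bigD1 a)//= eqxx big1; first by ring.
      by move=> i /negbTE ->.
    by rewrite (once d) ?eqxx ?(eq_sym d) ?(negbTE ad)//;
      rewrite /= ?eqxx ?mulr1n ?mulr0n; ring.
  have [<-|ad] := eqVneq a d.
    by rewrite (once c) ?eqxx ?(eq_sym c) ?(negbTE ac) //;
      rewrite /= ?eqxx ?mulr1n ?mulr0n; ring.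
  have [<-|cd] := eqVneq c d.
    by rewrite (pair a c) //;
      [rewrite /= ?eqxx ?mulr1n ?mulr0n; ring|by move=> i; case: (i == a); case: (i == _)].
  by rewrite (once c) ?eqxx ?(eq_sym c) ?(negbTE ac) ?(negbTE cd) ?(eq_sym d c) ?(negbTE cd)//;
      rewrite /= ?eqxx ?mulr1n ?mulr0n; ring.
have [<-|ac] := eqVneq a c.
  have [<-|bd] := eqVneq b d.
    by rewrite (pair a b) ?(eq_sym b a) ?(negbTE ab) //;
      [rewrite /= ?eqxx ?mulr1n ?mulr0n; ring|by move=> i; case: (i == a); case: (i == _)].
  by rewrite (once b) ?eqxx ?(eq_sym b a) ?(negbTE ab) ?(negbTE bd) //;
      rewrite /= ?eqxx ?mulr1n ?mulr0n; ring.
have [<-|ad] := eqVneq a d.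
  have [<-|bc] := eqVneq b c.
    by rewrite (pair a b) ?(eq_sym b a) ?(negbTE ab) //;
      [rewrite /= ?eqxx ?mulr1n ?mulr0n; ring|by move=> i; case: (i == a); case: (i == _)].
  by rewrite (once b) ?eqxx ?(eq_sym b a) ?(negbTE ab) ?(negbTE bc) //;
      rewrite /= ?eqxx ?mulr1n ?mulr0n; ring.
by rewrite (once a) ?eqxx ?(negbTE ab) ?(negbTE ac) ?(negbTE ad) //;
      rewrite /= ?eqxx ?mulr1n ?mulr0n; ring.
Qed.

Lemma prod_expr_eq (x : 'I_N -> R) (a : 'I_N) : \prod_i x i ^+ (i == a) = x a.
Proof.
rewrite (bigD1 a)//= eqxx expr1 big1 ?mulr1// => i /negbTE ->.
by rewrite expr0.
Qed.

End FourthMomentCombinatorics.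

(** * Variance of a quadratic form *)

Section QuadraticFormVariance.
Context {R : realFieldType} {N : nat}.
Variable B : 'I_N -> 'I_N -> R.
Implicit Types p q : 'I_N * 'I_N.

Lemma sum_delta (f : 'I_N * 'I_N -> R) p (P : pred ('I_N * 'I_N)) :
  (forall q, P q = (q == p)) -> \sum_q f q * (P q)%:R = f p.
Proof.
move=> hP; rewrite (bigD1 p)//= hP eqxx mulr1 big1 ?addr0// => q qp.
by rewrite hP (negbTE qp) mulr0.
Qed.

(** The bracket is the covariance of e_p1 e_p2 and e_q1 e_q2: centring has removed the pairing
    within p and within q. Summing over q leaves s2^2 B_ab (B_ab + B_ba) off the diagonal and (m4 -
    s2^2) B_aa^2 on it. *)
Lemma quadratic_variance_le (s2 m4 C F : R) : 0 <= s2 <= C -> m4 <= C -> 0 < C ->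
  \sum_p B p.1 p.2 ^+ 2 <= F ->
  \sum_p \sum_q B p.1 p.2 * B q.1 q.2 *
    (s2 ^+ 2 * ((p.1 == q.1)%:R * (p.2 == q.2)%:R + (p.1 == q.2)%:R * (p.2 == q.1)%:R)
     + (m4 - 3%:R * s2 ^+ 2) * ((p.1 == p.2)%:R * (p.1 == q.1)%:R * (p.1 == q.2)%:R))
  <= (2%:R * C ^+ 2 + C) * F.
Proof.
move=> /andP[s0 sC] mC C0 BF.
have swap : \sum_p B p.2 p.1 ^+ 2 = \sum_p B p.1 p.2 ^+ 2.
  rewrite -(pair_big xpredT xpredT (fun a b => B b a ^+ 2)) exchange_big pair_big.
  by apply: eq_bigr.
have S0 : 0 <= \sum_p B p.1 p.2 ^+ 2 by apply: sumr_ge0 => p _; exact: sqr_ge0.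
have s2C : s2 ^+ 2 <= C ^+ 2 by rewrite lerXn2r// nnegrE// ltW.
(* The weights 3/2 and 1/2 come from xy <= (x^2 + y^2)/2 with x = B_ab and y = B_ba. The sum of
   squares is invariant under transposition, so they recombine to 2. *)
apply: (@le_trans _ _ (\sum_p ((3%:R / 2%:R * C ^+ 2 + C) * B p.1 p.2 ^+ 2
                              + C ^+ 2 / 2%:R * B p.2 p.1 ^+ 2))); last first.
  rewrite big_split/= -!mulr_sumr swap -mulrDl.
  rewrite (_ : _ + C + _ = 2%:R * C ^+ 2 + C); last by field.
  by apply: ler_wpM2l => //; rewrite addr_ge0 ?mulr_ge0 ?sqr_ge0// ltW.
apply: ler_sum => -[a b] _ /=.
rewrite (_ : \sum_q _ = B a b * (s2 ^+ 2 * (B a b + B b a)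
    + (m4 - 3%:R * s2 ^+ 2) * ((a == b)%:R * B a a))); last first.
  rewrite -[X in s2 ^+ 2 * (X + _)](sum_delta (fun q => B q.1 q.2) (p := (a, b))
    (P := fun q => (a == q.1) && (b == q.2))); last first.
    by move=> [u v]; rewrite xpair_eqE /= (eq_sym a) (eq_sym b).
  rewrite -[X in s2 ^+ 2 * (_ + X)](sum_delta (fun q => B q.1 q.2) (p := (b, a))
    (P := fun q => (a == q.2) && (b == q.1))); last first.
    by move=> [u v]; rewrite xpair_eqE /= (eq_sym a) (eq_sym b) andbC.
  rewrite -[X in (a == b)%:R * X](sum_delta (fun q => B q.1 q.2) (p := (a, a))
    (P := fun q => (a == q.1) && (a == q.2))); last first.
    by move=> [u v]; rewrite xpair_eqE /= !(eq_sym a).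
  rewrite -big_split/= !mulr_sumr -big_split/= mulr_sumr.
  by apply: eq_bigr => q _; rewrite -!mulnb !natrM; ring.
have [<-|ab] := eqVneq a b.
  rewrite mul1r.
  have h1 : s2 ^+ 2 * B a a ^+ 2 <= C ^+ 2 * B a a ^+ 2 by apply: ler_wpM2r => //; exact: sqr_ge0.
  have h2 : m4 * B a a ^+ 2 <= C * B a a ^+ 2 by apply: ler_wpM2r => //; exact: sqr_ge0.
  have h3 : 0 <= s2 ^+ 2 * B a a ^+ 2 by rewrite mulr_ge0// sqr_ge0.
  have h4 : 0 <= C ^+ 2 * B a a ^+ 2 by rewrite mulr_ge0// sqr_ge0.
  by rewrite !expr2 in h1 h2 h3 h4 *; lra.
rewrite mul0r mulr0 addr0.
have h1 : s2 ^+ 2 * (B a b ^+ 2 + B a b * B b a) <=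
   s2 ^+ 2 * (3%:R / 2%:R * B a b ^+ 2 + B b a ^+ 2 / 2%:R).
  apply: ler_wpM2l; first exact: sqr_ge0.
  by have := sqr_ge0 (B a b - B b a); rewrite !expr2; lra.
have h2 : s2 ^+ 2 * (3%:R / 2%:R * B a b ^+ 2 + B b a ^+ 2 / 2%:R) <=
   C ^+ 2 * (3%:R / 2%:R * B a b ^+ 2 + B b a ^+ 2 / 2%:R).
  apply: ler_wpM2r => //.
  by have := sqr_ge0 (B a b); have := sqr_ge0 (B b a); lra.
have h3 : 0 <= C * B a b ^+ 2 by rewrite mulr_ge0 ?sqr_ge0// ltW.
by rewrite !expr2 in h1 h2 h3 *; lra.
Qed.

End QuadraticFormVariance.

(** * Oblique projections and rank-one updates *)

Section Dot.
Context {R : realFieldType}.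

Definition dot n (u v : 'cV[R]_n) : R := (u^T *m v) 0 0.

Lemma dotE n (u v : 'cV[R]_n) : dot u v = \sum_i u i 0 * v i 0.
Proof. by rewrite /dot mxE; apply: eq_bigr => i _; rewrite mxE. Qed.

Lemma dotC n (u v : 'cV[R]_n) : dot u v = dot v u.
Proof. by rewrite !dotE; apply: eq_bigr => i _; rewrite mulrC. Qed.

Lemma dotDr n (u v w : 'cV[R]_n) : dot u (v + w) = dot u v + dot u w.
Proof. by rewrite /dot mulmxDr mxE. Qed.

Lemma dotDl n (u v w : 'cV[R]_n) : dot (v + w) u = dot v u + dot w u.
Proof. by rewrite dotC dotDr !(dotC u). Qed.

Lemma dotZr n k (u v : 'cV[R]_n) : dot u (k *: v) = k * dot u v.
Proof. by rewrite /dot -scalemxAr mxE. Qed.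

Lemma dotZl n k (u v : 'cV[R]_n) : dot (k *: u) v = k * dot u v.
Proof. by rewrite dotC dotZr dotC. Qed.

Lemma dotNr n (u v : 'cV[R]_n) : dot u (- v) = - dot u v.
Proof. by rewrite -scaleN1r dotZr mulN1r. Qed.

Lemma dotNl n (u v : 'cV[R]_n) : dot (- u) v = - dot u v.
Proof. by rewrite dotC dotNr dotC. Qed.

Lemma dotBr n (u v w : 'cV[R]_n) : dot u (v - w) = dot u v - dot u w.
Proof. by rewrite dotDr dotNr. Qed.

Lemma dot_mull m n (A : 'M[R]_(m, n)) u v : dot (A *m u) v = dot u (A^T *m v).
Proof. by rewrite /dot trmx_mul mulmxA. Qed.

Lemma dot_mulr m n (A : 'M[R]_(m, n)) u v : dot u (A *m v) = dot (A^T *m u) v.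
Proof. by rewrite dot_mull trmxK. Qed.

Lemma dot_ge0 n (u : 'cV[R]_n) : 0 <= dot u u.
Proof. by rewrite dotE sumr_ge0// => i _; rewrite -expr2 sqr_ge0. Qed.

Lemma dot_eq0 n (u : 'cV[R]_n) : dot u u = 0 -> u = 0.
Proof.
rewrite dotE => /psumr_eq0P h; apply/matrixP => i j; rewrite ord1 mxE.
by have /eqP := h (fun i _ => sqr_ge0 (u i 0)) i isT; rewrite mulf_eq0 orbb => /eqP.
Qed.

Lemma outer_mul m n (l : 'cV[R]_m) (a u : 'cV[R]_n) : l *m a^T *m u = dot a u *: l.
Proof. by rewrite -mulmxA [a^T *m u]mx11_scalar mul_mx_scalar. Qed.

Lemma dot_cauchy n (u v : 'cV[R]_n) : dot u v ^+ 2 <= dot u u * dot v v.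
Proof.
have [v0|v0] := eqVneq (dot v v) 0.
  by rewrite (dot_eq0 v0) -(scale0r 0) !dotZr !mul0r expr0n mulr0.
have vp : 0 < dot v v by rewrite lt_neqAle eq_sym v0 dot_ge0.
have := dot_ge0 (dot v v *: u - dot u v *: v).
rewrite dotBr !(dotC (_ - _)) !dotBr !dotZr !dotZl (dotC v u) => h.
have : 0 <= dot v v * (dot u u * dot v v - dot u v ^+ 2).
  by apply: le_trans h _; rewrite le_eqVlt; apply/orP; left; apply/eqP; ring.
by rewrite pmulr_rge0// subr_ge0.
Qed.

Lemma dotD_sq_le n (u v : 'cV[R]_n) : dot (u + v) (u + v) <= 2%:R * dot u u + 2%:R * dot v v.
Proof.
have := dot_ge0 (u - v).
by rewrite !dotDr !dotNr !dotDl !dotNl (dotC v u); lra.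
Qed.

Definition coercive n (c : R) (Q : 'M[R]_n) := forall v, c * dot v v <= dot v (Q *m v).

(** Here b bounds the square of the operator norm, so that the algebra needs no square roots and
    works over any [realFieldType]. *)
Definition sq_bounded n (b : R) (Q : 'M[R]_n) := forall v, dot (Q *m v) (Q *m v) <= b * dot v v.

Lemma coercive_tr n c (Q : 'M[R]_n) : coercive c Q -> coercive c Q^T.
Proof. by move=> h v; rewrite dot_mulr trmxK dotC. Qed.

(** By Cauchy-Schwarz |Q'v|^2 = v'QQ'v <= |v| |QQ'v|. Square this, use the bound for Q at the vector
    Q'v, and divide by |Q'v|^2. *)
Lemma sq_bounded_tr n b (Q : 'M[R]_n) : 0 <= b -> sq_bounded b Q -> sq_bounded b Q^T.
Proof.
move=> b0 h v; set x := dot _ _.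
have [->|x0] := eqVneq x 0; first by rewrite mulr_ge0// dot_ge0.
have xp : 0 < x by rewrite lt_neqAle eq_sym x0 dot_ge0.
have xE : x = dot v (Q *m (Q^T *m v)) by rewrite /x dot_mull trmxK.
have : x ^+ 2 <= dot v v * (b * x).
  rewrite {1}xE; apply: le_trans (dot_cauchy _ _) _.
  by apply: ler_wpM2l; [exact: dot_ge0|exact: h].
by rewrite mulrCA mulrA expr2 ler_pM2r// mulrC.
Qed.

Lemma unitmx_inj n (A : 'M[R]_n) : (forall u : 'cV[R]_n, A *m u = 0 -> u = 0) -> A \in unitmx.
Proof.
move=> h; rewrite -unitmx_tr -row_free_unit -kermx_eq0; apply/eqP/row_matrixP => i.
rewrite row0; apply: trmx_inj; rewrite trmx0; apply: h.
by rewrite -{1}[A]trmxK -trmx_mul -row_mul mulmx_ker row0 trmx0.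
Qed.

Lemma full_col_rank_inj n k (X : 'M[R]_(n, k)) (u : 'cV[R]_k) :
  \rank X = k -> X *m u = 0 -> u = 0.
Proof.
move=> rX Xu; have fX : row_free X^T by rewrite /row_free mxrank_tr rX.
apply: trmx_inj; rewrite trmx0; apply/eqP; rewrite -(mulmx_free_eq0 _ fX).
by rewrite -trmx_mul Xu trmx0.
Qed.

End Dot.

Section ObliqueProjection.
Context {R : realFieldType} {n k : nat}.
Variables (X : 'M[R]_(n, k)) (Q : 'M[R]_n) (c : R).
Hypotheses (c0 : 0 < c) (cQ : coercive c Q).

Definition gram := X^T *m Q *m X.
(** For an invertible Gram matrix, the oblique projection whose kernel is the column space of X and
    whose image is the kernel of X'Q. With Q = 1 - G it is [MG X G] by conversion. *)
Definition residual_maker := 1%:M - X *m invmx gram *m X^T *m Q.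

Lemma gram_unit : \rank X = k -> gram \in unitmx.
Proof.
move=> rX; apply: unitmx_inj => u Su; apply: (full_col_rank_inj rX).
have h := cQ (X *m u).
have : dot (X *m u) (Q *m (X *m u)) = 0.
  by rewrite dot_mull !mulmxA -/gram Su /dot mulmx0 mxE.
move=> e; rewrite e in h; apply/dot_eq0/eqP.
by rewrite eq_le dot_ge0 andbT -(pmulr_rle0 _ c0).
Qed.

Hypothesis unitS : gram \in unitmx.
Let M := residual_maker.
Let A := Q *m M.

Lemma tr_residual0 : X^T *m Q *m M = 0.
Proof. by rewrite mulmxBr mulmx1 !mulmxA -/gram mulmxV// mul1mx subrr. Qed.

Lemma residual_mulX : M *m X = 0.
Proof. by rewrite mulmxBl mul1mx -!mulmxA (mulmxA X^T) -/gram mulVmx// mulmx1 subrr. Qed.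

Lemma residual_idem : M *m M = M.
Proof.
rewrite {1}/M /residual_maker mulmxBl mul1mx -!mulmxA (mulmxA X^T).
by rewrite tr_residual0 !mulmx0 subr0.
Qed.

(** The correction term of M' ends in X', and X'QM = 0. This is how A inherits coercivity: u'Au =
    (Mu)'Q(Mu). *)
Lemma residual_sandwich : M^T *m Q *m M = A.
Proof.
have MT : M^T = 1%:M - Q^T *m X *m (X *m invmx gram)^T.
  by rewrite /M /residual_maker linearB /= trmx1 !trmx_mul trmxK !mulmxA.
rewrite MT -mulmxA mulmxBl mul1mx -/A.
rewrite !trmx_mul -!mulmxA (mulmxA X^T) tr_residual0 !mulmx0 subr0 //.
Qed.

Lemma residual_trace : \tr M = n%:R - k%:R.
Proof.
rewrite /M /residual_maker raddfB /= mxtrace1; congr (_ - _).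
by rewrite -!mulmxA mxtrace_mulC -!mulmxA (mulmxA X^T) -/gram mulVmx// mxtrace1.
Qed.

(* By 2xy <= x^2 + y^2 applied to tr B = tr (B B). *)
Lemma trace_frobenius (B : 'M[R]_n) : B *m B = B -> \tr B <= \sum_i \sum_j B i j ^+ 2.
Proof.
move=> BB; rewrite -{1}BB /mxtrace.
have -> : \sum_i (B *m B) i i = \sum_i \sum_j B i j * B j i.
  by apply: eq_bigr => i _; rewrite mxE.
have swap : \sum_i \sum_j B j i ^+ 2 = \sum_i \sum_j B i j ^+ 2 by exact: exchange_big.
rewrite -(ler_pM2l (ltr0Sn R 1)).
have -> : 2%:R * \sum_i \sum_j B i j ^+ 2 = \sum_i \sum_j B i j ^+ 2 + \sum_i \sum_j B j i ^+ 2.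
  by rewrite swap; ring.
rewrite -big_split mulr_sumr /=.
apply: ler_sum => i _; rewrite mulr_sumr -big_split/=; apply: ler_sum => j _.
by have := sqr_ge0 (B i j - B j i); rewrite !expr2; lra.
Qed.

Lemma dot_delta (B : 'M[R]_n) i j : B i j = dot (delta_mx i 0) (B *m delta_mx j 0).
Proof.
rewrite /dot trmx_delta mulmxA -rowE -colE; rewrite !mxE //.
Qed.

Lemma dot_delta_delta (i : 'I_n) : dot (delta_mx i 0 : 'cV[R]_n) (delta_mx i 0) = 1.
Proof. by rewrite /dot trmx_delta mul_delta_mx mxE !eqxx. Qed.

Lemma sum_sq_col (B : 'M[R]_n) :
  \sum_i \sum_j B i j ^+ 2 = \sum_j dot (B *m delta_mx j 0) (B *m delta_mx j 0).
Proof.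
rewrite exchange_big; apply: eq_bigr => j _; rewrite dotE.
by apply: eq_bigr => i _; rewrite -colE mxE expr2.
Qed.

(** The diagonal entries of M'QM are the values of the form Q at the columns of M, so coercivity
    yields c times the squared Frobenius norm of M, which for an idempotent is at least its
    trace. *)
Lemma trace_residual_ge : c * (n%:R - k%:R) <= \tr A.
Proof.
rewrite -residual_trace.
apply: (@le_trans _ _ (c * \sum_i \sum_j M i j ^+ 2)).
  by rewrite ler_pM2l// trace_frobenius// residual_idem.
rewrite sum_sq_col mulr_sumr -residual_sandwich /mxtrace.
apply: ler_sum => i _; rewrite [leRHS]dot_delta -!mulmxA [leRHS]dot_mulr trmxK.
exact: cQ.
Qed.

Hypothesis bQ : sq_bounded 4%:R Q.

(** The chain is c|Mu|^2 <= (Mu)'Q(Mu) = u'QMu <= 2|u||Mu|, where 2 is the norm bound for Q. *)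
Lemma residual_sq_bounded : sq_bounded (4%:R / c ^+ 2) M.
Proof.
move=> u; set x := dot _ _.
have c2 : 0 < c ^+ 2 by rewrite exprn_gt0.
have [->|x0] := eqVneq x 0; first by rewrite mulr_ge0 ?dot_ge0// divr_ge0// ltW.
have xp : 0 < x by rewrite lt_neqAle eq_sym x0 dot_ge0.
have h1 : c * x <= dot u (Q *m (M *m u)).
  apply: le_trans (cQ _) _; rewrite dot_mull !mulmxA residual_sandwich //.
have h2 : (c * x) ^+ 2 <= dot u u * (4%:R * x).
  apply: (@le_trans _ _ (dot u (Q *m (M *m u)) ^+ 2)).
    have cx0 : 0 <= c * x by rewrite ltW// mulr_gt0.
    by rewrite lerXn2r// nnegrE (le_trans cx0).
  apply: le_trans (dot_cauchy _ _) _; apply: ler_wpM2l; first exact: dot_ge0.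
  exact: bQ.
rewrite -mulrA mulrCA ler_pdivlMl//.
rewrite -(ler_pM2r xp); move: h2; rewrite !expr2 => h2; lra.
Qed.

Lemma A_sq_bounded : sq_bounded (16%:R / c ^+ 2) A.
Proof.
move=> u; rewrite /A -mulmxA; apply: le_trans (bQ _) _.
have := residual_sq_bounded u; rewrite -(ler_pM2l (ltr0Sn R 3)) => /le_trans; apply.
by rewrite !mulrA -natrM.
Qed.

Lemma A_sum_sq_le : \sum_i \sum_j A i j ^+ 2 <= 16%:R / c ^+ 2 * n%:R.
Proof.
have -> : 16%:R / c ^+ 2 * n%:R = \sum_(j < n) 16%:R / c ^+ 2.
  by rewrite sumr_const card_ord mulr_natr.
rewrite sum_sq_col.
by apply: ler_sum => j _; apply: le_trans (A_sq_bounded _) _; rewrite dot_delta_delta mulr1 ?lexx.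
Qed.

Lemma A_entry_le i j : `|A i j| <= 4%:R / c.
Proof.
rewrite -(ler_pXn2r (isT : (0 < 2)%N)) ?nnegrE ?divr_ge0 ?(ltW c0)// real_normK ?num_real//.
rewrite dot_delta; apply: le_trans (dot_cauchy _ _) _.
rewrite dot_delta_delta mul1r; apply: le_trans (A_sq_bounded _) _.
by rewrite dot_delta_delta mulr1 expr_div_n -natrX.
Qed.

Variable a : 'cV[R]_k.
Hypothesis rX : \rank X = k.
Let v := invmx gram *m a.
Let s := dot a v.
Let g := Q *m X *m v.
Let kappa := dot a (invmx (X^T *m X) *m a).

Lemma gram_quadratic : c * dot (X *m v) (X *m v) <= s.
Proof.
apply: le_trans (cQ _) _.
by rewrite dot_mull !mulmxA -/gram -mulmxA mulKVmx// dotC.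
Qed.

Lemma gram_inv_ge0 : 0 <= s.
Proof. by apply: le_trans gram_quadratic; rewrite mulr_ge0 ?dot_ge0// ltW. Qed.

Lemma gram1_unit : X^T *m X \in unitmx.
Proof.
apply: unitmx_inj => u Su; apply: (full_col_rank_inj rX).
by apply: dot_eq0; rewrite dot_mull mulmxA Su /dot mulmx0 mxE.
Qed.

(** S is not symmetric, so the two inverses are not compared through an order on matrices. With z =
    (X'X)^-1 a one has s = <Xz, Xv> and kappa = |Xz|^2; Cauchy-Schwarz and c|Xv|^2 <= s then give c
    s^2 <= kappa s. *)
Lemma gram_inv_le : s <= kappa / c.
Proof.
pose z := invmx (X^T *m X) *m a.
have az : X^T *m X *m z = a by rewrite /z mulKVmx// gram1_unit.
have kz : kappa = dot (X *m z) (X *m z) by rewrite dot_mull mulmxA az dotC.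
have sz : s = dot (X *m z) (X *m v) by rewrite dot_mulr mulmxA az.
have [s0|s0] := eqVneq s 0.
  by rewrite s0 divr_ge0 ?(ltW c0)// kz dot_ge0.
have sp : 0 < s by rewrite lt_neqAle eq_sym s0 gram_inv_ge0.
rewrite ler_pdivlMr// -(ler_pM2r sp).
apply: (@le_trans _ _ (c * (kappa * dot (X *m v) (X *m v)))).
  rewrite (_ : s * c * s = c * s ^+ 2); last by ring.
  by rewrite ler_pM2l// sz kz; exact: dot_cauchy.
rewrite mulrCA; apply: ler_wpM2l; first by rewrite kz dot_ge0.
exact: gram_quadratic.
Qed.

Lemma g_sq_le : dot g g <= 4%:R * kappa / c ^+ 2.
Proof.
rewrite /g -mulmxA; apply: le_trans (bQ _) _; rewrite -mulrA ler_pM2l//.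
rewrite expr2 invfM mulrA ler_pdivlMr// mulrC.
exact: le_trans gram_quadratic gram_inv_le.
Qed.

End ObliqueProjection.

(** * Rank-one perturbation of the regressors *)

Section RankOneUpdate.
Context {R : realFieldType} {n k : nat}.
Variables (X : 'M[R]_(n, k)) (Q : 'M[R]_n) (a : 'cV[R]_k) (l : 'cV[R]_n).
Hypothesis unitS : gram X Q \in unitmx.
Let A := Q *m residual_maker X Q.
Let v := invmx (gram X Q) *m a.
Let s := dot a v.
Let g := Q *m X *m v.
Let h := Q^T *m X *m (invmx (gram X Q^T) *m a).
Let X1 := X + l *m a^T.

Lemma gram_tr : gram X Q^T = (gram X Q)^T.
Proof. by rewrite /gram !trmx_mul trmxK mulmxA. Qed.

(** Identifies h: it represents the functional that sends y to a' times the coefficient vector of y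
    on X. *)
Lemma h_dot (y : 'cV[R]_n) : dot h y = dot a (invmx (gram X Q) *m (X^T *m (Q *m y))).
Proof.
by rewrite /h gram_tr -trmx_inv -!mulmxA !dot_mull !trmxK.
Qed.

Lemma A_mul (y : 'cV[R]_n) : A *m y = Q *m y - Q *m X *m (invmx (gram X Q) *m (X^T *m (Q *m y))).
Proof. by rewrite /A /residual_maker mulmxBr mulmx1 mulmxBl !mulmxA. Qed.

Lemma X1_mul (u : 'cV[R]_k) : X1 *m u = X *m u + dot a u *: l.
Proof. by rewrite /X1 mulmxDl outer_mul. Qed.

(* [tau] and [rho] are the two scalars through which the rank-one update enters
   the normal equations; they solve a 2x2 linear system. *)
Lemma normal_equations_update (y : 'cV[R]_n) (u : 'cV[R]_k) :
  X1^T *m (Q *m (y - X1 *m u)) = 0 ->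
  let tau := dot a u in let rho := dot l (Q *m (y - X1 *m u)) in
  [/\ tau * (1 + dot h l) = dot h y + rho * s,
      rho * (1 + dot l g) + tau * dot l (A *m l) = dot l (A *m y),
      u = invmx (gram X Q) *m (X^T *m (Q *m (y - tau *: l))) + rho *: v &
      Q *m (y - X1 *m u) = A *m y - tau *: (A *m l) - rho *: g].
Proof.
set r := Q *m _ => X1r tau rho.
(* The equation for X1 expands to X'r + rho a = 0: orthogonality to X fails in the direction a
   only. *)
have Xr : X^T *m r = - (rho *: a).
  apply/eqP; rewrite -addr_eq0; apply/eqP.
  by rewrite -[RHS]X1r /X1 linearD /= trmx_mul trmxK mulmxDl outer_mul.
have rE : r = Q *m (y - tau *: l) - Q *m X *m u.
  by rewrite /r X1_mul -mulmxA -mulmxBr opprD addrA addrAC.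
have Su : gram X Q *m u = X^T *m (Q *m (y - tau *: l)) + rho *: a.
  by rewrite -[rho *: a]opprK -Xr rE (mulmxBr X^T (Q *m _)) opprB addrC subrK /gram !mulmxA.
have uE : u = invmx (gram X Q) *m (X^T *m (Q *m (y - tau *: l))) + rho *: v.
  by rewrite -[LHS](mulKmx unitS) Su mulmxDr -scalemxAr.
have rE2 : r = A *m y - tau *: (A *m l) - rho *: g.
  have Xu : Q *m X *m u = Q *m X *m (invmx (gram X Q) *m (X^T *m (Q *m (y - tau *: l))))
      + rho *: g.
    by rewrite {1}uE (mulmxDr (Q *m X) _ (rho *: v)) -scalemxAr.
  by rewrite scalemxAr -mulmxBr rE Xu A_mul opprD addrA.
split => //.
- have : tau = dot h (y - tau *: l) + rho * s.
    by rewrite {1}/tau {1}uE (dotDr a) (dotZr rho) -h_dot.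
  by rewrite dotBr dotZr => E; rewrite mulrDr mulr1 {1}E; ring.
- have : rho = dot l (A *m y) - tau * dot l (A *m l) - rho * dot l g.
    by rewrite {1}/rho rE2 !dotBr !dotZr.
  by move=> E; rewrite mulrDr mulr1 {1}E; ring.
Qed.

Let Delta := (1 + dot l g) * (1 + dot h l) + s * dot l (A *m l).
Hypothesis Delta0 : Delta != 0.

(** [Delta] is the determinant of the system for tau and rho. A kernel vector u of the updated Gram
    matrix solves the normal equations with y = 0, so both scalars vanish by Cramer's rule, and they
    determine u. *)
Lemma gram_update_unit : gram X1 Q \in unitmx.
Proof.
apply: unitmx_inj => u Su.
have [|E1 E2 uE _] := @normal_equations_update 0 u.
  by rewrite sub0r !mulmxN !mulmxA -/(gram X1 Q) Su oppr0.
move: E1 E2 uE; set tau := dot a u; set rho := dot l _.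
rewrite mulmx0 !/(dot _ 0) !mulmx0 mxE add0r => E1 E2 uE.
have tD : tau * Delta = 0.
  transitivity ((1 + dot l g) * (tau * (1 + dot h l) - rho * s)
    + s * (rho * (1 + dot l g) + tau * dot l (A *m l))).
    by rewrite /Delta; ring.
  by rewrite E1 E2 subrr !mulr0 addr0.
have rD : rho * Delta = 0.
  transitivity ((1 + dot h l) * (rho * (1 + dot l g) + tau * dot l (A *m l))
    - dot l (A *m l) * (tau * (1 + dot h l) - rho * s)).
    by rewrite /Delta; ring.
  by rewrite E1 E2 subrr !mulr0 subr0.
have t0 : tau = 0 by apply/eqP; move/eqP: tD; rewrite mulf_eq0 (negbTE Delta0) orbF.
have r0 : rho = 0 by apply/eqP; move/eqP: rD; rewrite mulf_eq0 (negbTE Delta0) orbF.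
by rewrite uE t0 r0 !scale0r subr0 !mulmx0 addr0.
Qed.

(** X1' annihilates the Q-weighted residual, so beta drops out and only the product of e with that
    residual remains. Its closed form is known up to tau and rho, which Cramer's rule supplies. *)
Lemma residual_quadratic_update (beta : 'cV[R]_k) (e : 'cV[R]_n) :
  let y := X1 *m beta + e in
  dot y (Q *m residual_maker X1 Q *m y) =
  dot e (A *m e)
  - (dot h e * (1 + dot l g) + s * dot l (A *m e)) / Delta * dot e (A *m l)
  - ((1 + dot h l) * dot l (A *m e) - dot l (A *m l) * dot h e) / Delta * dot e g.
Proof.
move=> y; have U1 := gram_update_unit.
pose u := invmx (gram X1 Q) *m (X1^T *m (Q *m e)).
have My : residual_maker X1 Q *m y = e - X1 *m u.
  rewrite /y mulmxDr mulmxA residual_mulX// mul0mx add0r.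
  by rewrite /residual_maker mulmxBl mul1mx /u !mulmxA.
have X1r : X1^T *m (Q *m (e - X1 *m u)) = 0.
  by rewrite -My !mulmxA tr_residual0// mul0mx.
have [E1 E2 _ rE] := normal_equations_update X1r.
rewrite -mulmxA My /y dotDl dot_mull X1r {1}/dot mulmx0 mxE add0r rE.
rewrite !dotBr !dotZr; congr (_ - _ * _ - _ * _); apply: (mulIf Delta0); rewrite divfK//.
(* Once l'Ae and h'e are replaced through the two equations of the system, Cramer's formula is a
   ring identity. *)
- rewrite -[in RHS]E2 -[dot h e](addrK (dot l (Q *m (e - X1 *m u)) * s)) -E1 /Delta.
  ring.
- rewrite -[in RHS]E2 -[dot h e](addrK (dot l (Q *m (e - X1 *m u)) * s)) -E1 /Delta.
  ring.
Qed.

(** The vector v = S^-1 a solves the updated equation up to a scalar: S1 v = (1 + k0 s) a. The same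
    scalar being nonzero makes S1 invertible. *)
Lemma sherman_morrison_quadratic (k0 : R) : 1 + k0 * s != 0 ->
  dot a (invmx (gram X Q + k0 *: (a *m a^T)) *m a) = s / (1 + k0 * s).
Proof.
move=> ks0; set S1 := _ + _.
have S1E u : S1 *m u = gram X Q *m u + (k0 * dot a u) *: a.
  by rewrite mulmxDl -scalemxAl outer_mul scalerA.
have U1 : S1 \in unitmx.
  apply: unitmx_inj => u; rewrite S1E => /eqP; rewrite addr_eq0 => /eqP Su.
  have uE : u = - (k0 * dot a u) *: v.
    by rewrite -[LHS](mulKmx unitS) Su mulmxN -scalemxAr scaleNr.
  have : dot a u * (1 + k0 * s) = 0.
    by rewrite mulrDr mulr1 {1}uE dotZr -/s; ring.
  move/eqP; rewrite mulf_eq0 (negbTE ks0) orbF => /eqP au.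
  by rewrite uE au mulr0 oppr0 scale0r.
have E : S1 *m v = (1 + k0 * s) *: a.
  by rewrite S1E mulKVmx// -/s scalerDl scale1r.
have -> : invmx S1 *m a = (1 + k0 * s)^-1 *: v.
  by rewrite -[v in RHS](mulKmx U1) E -scalemxAr scalerA mulVf// scale1r.
by rewrite dotZr mulrC.
Qed.

End RankOneUpdate.

(** * Forms in current and lagged errors as forms in one error vector *)

Section Embedding.
Context {R : comNzRingType} {n N : nat}.
Variables (sg sg' : 'I_n -> 'I_N) (inj_sg : injective sg) (inj_sg' : injective sg').

(** Current and lagged errors are overlapping windows of one vector of independent variables. Zero
    padding turns each mixed form into a form in that vector, so a single variance bound serves
    e'Ae, l'Al, l'Ae and e'Al. *)
Definition embed_mx (A : 'M[R]_n) (a b : 'I_N) : R :=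
  \sum_i \sum_j (sg i == a)%:R * (sg' j == b)%:R * A i j.

Lemma sum_embed_mx (A : 'M[R]_n) (f : 'I_N -> 'I_N -> R) :
  \sum_(p : 'I_N * 'I_N) embed_mx A p.1 p.2 * f p.1 p.2 =
  \sum_i \sum_j A i j * f (sg i) (sg' j).
Proof.
transitivity (\sum_(p : 'I_N * 'I_N) \sum_i \sum_j
    (sg i == p.1)%:R * (sg' j == p.2)%:R * A i j * f p.1 p.2).
  by apply: eq_bigr => p _; rewrite mulr_suml; apply: eq_bigr => i _; rewrite mulr_suml.
rewrite exchange_big; apply: eq_bigr => i _.
rewrite exchange_big; apply: eq_bigr => j _.
rewrite (bigD1 (sg i, sg' j))//= !eqxx !mul1r big1 ?addr0// => -[a b].
rewrite xpair_eqE negb_and /= => /orP[h|h].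
  by rewrite (eq_sym (sg i)) (negbTE h) !mul0r.
by rewrite (eq_sym (sg' j)) (negbTE h) mulr0 !mul0r.
Qed.

Lemma embed_mxE (A : 'M[R]_n) i j : embed_mx A (sg i) (sg' j) = A i j.
Proof.
rewrite /embed_mx (bigD1 i)//= (bigD1 j)//= !eqxx !mul1r !big1 ?addr0//.
- move=> i' i'i; rewrite big1// => j' _.
  by rewrite (inj_eq inj_sg) (negbTE i'i) !mul0r.
- by move=> j' j'j; rewrite (inj_eq inj_sg') (negbTE j'j) mulr0 !mul0r.
Qed.

(** Injectivity of the two index maps keeps distinct entries of A in distinct positions, so no
    squares merge. *)
Lemma sum_embed_mx_sq (A : 'M[R]_n) :
  \sum_(p : 'I_N * 'I_N) embed_mx A p.1 p.2 ^+ 2 = \sum_i \sum_j A i j ^+ 2.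
Proof.
under eq_bigr do rewrite expr2.
rewrite sum_embed_mx; apply: eq_bigr => i _; apply: eq_bigr => j _.
by rewrite embed_mxE expr2.
Qed.

Definition embed_vec (h : 'cV[R]_n) (a : 'I_N) : R := \sum_i (sg i == a)%:R * h i 0.

Lemma sum_embed_vec (h : 'cV[R]_n) (f : 'I_N -> R) :
  \sum_a embed_vec h a * f a = \sum_i h i 0 * f (sg i).
Proof.
transitivity (\sum_a \sum_i (sg i == a)%:R * h i 0 * f a).
  by apply: eq_bigr => a _; rewrite mulr_suml.
rewrite exchange_big; apply: eq_bigr => i _.
rewrite (bigD1 (sg i))//= eqxx mul1r big1 ?addr0// => a h'.
by rewrite eq_sym (negbTE h') !mul0r.
Qed.

Lemma sum_embed_vec_sq (h : 'cV[R]_n) :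
  \sum_a embed_vec h a ^+ 2 = \sum_i h i 0 ^+ 2.
Proof.
under eq_bigr do rewrite expr2.
rewrite sum_embed_vec; apply: eq_bigr => i _.
rewrite expr2; congr (_ * _).
rewrite /embed_vec (bigD1 i)//= eqxx mul1r big1 ?addr0// => i' i'i.
by rewrite (inj_eq inj_sg) (negbTE i'i) mul0r.
Qed.

End Embedding.

(** * Perturbation of the limit formula *)

Section Perturbation.
Context {R : realFieldType}.
Implicit Types x y z : R.

Lemma ler_normM x y (X Y : R) : `|x| <= X -> `|y| <= Y -> `|x * y| <= X * Y.
Proof. by move=> hx hy; rewrite normrM ler_pM. Qed.

Lemma ler_normD2 x y (X Y : R) : `|x| <= X -> `|y| <= Y -> `|x + y| <= X + Y.
Proof. by move=> hx hy; rewrite (le_trans (ler_normD _ _))// lerD. Qed.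

Lemma ler_normB2 x y (X Y : R) : `|x| <= X -> `|y| <= Y -> `|x - y| <= X + Y.
Proof. by move=> hx hy; rewrite (le_trans (ler_normB _ _))// lerD. Qed.

(** Here b1 bounds the limits of the scaled forms and p1 bounds n s. The summands are the errors
    caused by he (1 + lg), by p q3 and by tau0 Delta; the factor 2 from 1 / Delta is put in where
    this is used. *)
Definition tau_modulus (b1 p1 : R) := 2%:R + p1 + p1 * b1 * (3%:R + p1).

(** The summands account, in this order, for q1 - b, (tau - tau0) q4, tau0 (q4 - v) and rho eg. *)
Definition perturbation_modulus (b1 p1 : R) :=
  1 + 2%:R * tau_modulus b1 p1 * (b1 + 1) + p1 * b1 + 6%:R * (b1 + 1).

Lemma Delta_perturbation (b p p1 delta q2 hl lg : R) :
  0 <= p <= p1 -> 0 <= delta <= 1 ->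
  `|q2 - b| <= delta -> `|hl| <= delta -> `|lg| <= delta ->
  `|(1 + lg) * (1 + hl) + p * q2 - (1 + p * b)| <= (3%:R + p1) * delta.
Proof.
move=> /andP[p0 pp1] /andP[d0 d1] hq hh hg.
have -> : (1 + lg) * (1 + hl) + p * q2 - (1 + p * b) = lg + hl + lg * hl + p * (q2 - b).
  by ring.
have -> : (3%:R + p1) * delta = delta + delta + delta * 1 + p1 * delta by ring.
apply: ler_normD2; last by apply: ler_normM => //; rewrite ger0_norm.
apply: ler_normD2; first exact: ler_normD2.
by apply: ler_normM => //; exact: le_trans hh d1.
Qed.

(** Here q1, ..., q4 stand for e'Ae, l'Al, l'Ae, e'Al divided by n, with limits b, b, u, v, and p
    stands for n s. Since 1 + p b >= 1, the second smallness condition on delta keeps Delta above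
    1/2. Only tau needs a limit: for rho a bound is enough, as it multiplies the small form eg. *)
Lemma variance_ratio_perturbation
  (b b1 p p1 u v delta q1 q2 q3 q4 he hl eg lg : R) :
  0 <= b <= b1 -> 0 <= p <= p1 -> `|u| <= b1 -> `|v| <= b1 ->
  0 <= delta <= 1 -> (3%:R + p1) * delta <= 1 / 2%:R ->
  `|q1 - b| <= delta -> `|q2 - b| <= delta -> `|q3 - u| <= delta -> `|q4 - v| <= delta ->
  `|he| <= delta -> `|hl| <= delta -> `|eg| <= delta -> `|lg| <= delta ->
  let Delta := (1 + lg) * (1 + hl) + p * q2 in
  1 / 2%:R <= Delta /\
  `|q1 - (he * (1 + lg) + p * q3) / Delta * q4 - ((1 + hl) * q3 - q2 * he) / Delta * eg
    - (b - p * u * v / (1 + p * b))| <= perturbation_modulus b1 p1 * delta.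
Proof.
move=> hb hp hu hv hd d12 h1 h2 h3 h4 hhe hhl heg hlg Delta.
have DD := Delta_perturbation hp hd h2 hhl hlg; rewrite -/Delta in DD.
move: hb hp hd => /andP[b0 bb1] /andP[p0 pp1] /andP[d0 d1].
have pb0 : 0 <= p * b by rewrite mulr_ge0.
have b10 : 0 <= b1 by exact: le_trans bb1.
have p10 : 0 <= p1 by exact: le_trans pp1.
have Dge : 1 / 2%:R <= Delta.
  by have := ler_norm (- (Delta - (1 + p * b))); rewrite normrN; lra.
split => //.
have D0 : Delta != 0 by rewrite gt_eqF//; lra.
have iD x X : `|x| <= X -> `|x / Delta| <= 2%:R * X.
  move=> hx; rewrite normrM normfV mulrC (le_trans (ler_wpM2l _ hx)) ?invr_ge0//.
  apply: ler_wpM2r; first exact: le_trans hx.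
  rewrite ger0_norm; last lra.
  by rewrite -[leRHS]invrK lef_pV2 ?posrE; [lra|lra|rewrite invr_gt0; lra].
set D1 := 1 + p * b in DD *.
have D1ge : 1 <= D1 by rewrite /D1; lra.
have D10 : D1 != 0 by rewrite gt_eqF//; lra.
pose tau0 := p * u / D1.
have tau0b : `|tau0| <= p1 * b1.
  rewrite /tau0 normrM normfV ler_pdivrMr ?normr_gt0//.
  rewrite (le_trans (ler_normM (_ : `|p| <= p1) hu)) ?ger0_norm//.
    by rewrite ler_peMr ?mulr_ge0//.
  lra.
set tau := (he * (1 + lg) + p * q3) / Delta.
set rho := ((1 + hl) * q3 - q2 * he) / Delta.
have n1 x : `|x| <= delta -> `|1 + x| <= 2%:R.
  by move=> hx; rewrite (_ : 2%:R = 1 + 1 :> R)// ler_normD2 ?normr1// (le_trans hx).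
have nq q z : `|z| <= b1 -> `|q - z| <= delta -> `|q| <= b1 + 1.
  by move=> hz hq; rewrite -(subrK z q) addrC ler_normD2// (le_trans hq).
have nb : `|b| <= b1 by rewrite ger0_norm.
have tauE : `|tau - tau0| <= 2%:R * tau_modulus b1 p1 * delta.
  have -> : tau - tau0 = (he * (1 + lg) + p * (q3 - u) - tau0 * (Delta - D1)) / Delta.
    apply: (mulIf D0); rewrite mulrBl /tau !divfK//.
    have e : tau0 * D1 = p * u by rewrite /tau0 divfK.
    by rewrite (mulrBr tau0) e; ring.
  rewrite -mulrA; apply: iD.
  have -> : tau_modulus b1 p1 * delta =
    delta * 2%:R + p1 * delta + p1 * b1 * ((3%:R + p1) * delta).
    by rewrite /tau_modulus; ring.
  apply: ler_normB2; last exact: ler_normM.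
  apply: ler_normD2; first by apply: ler_normM => //; exact: n1.
  by apply: ler_normM => //; rewrite ger0_norm.
(* The 6 is 2, from 1 / Delta, times 2 + 1, from |1 + hl| <= 2 and |he| <= 1; both |q3| and |q2| are
   at most b1 + 1. *)
have rhob : `|rho| <= 6%:R * (b1 + 1).
  have -> : 6%:R * (b1 + 1) = 2%:R * (2%:R * (b1 + 1) + (b1 + 1) * 1) by ring.
  apply: iD; apply: ler_normB2; apply: ler_normM; first exact: n1.
  - exact: nq h3.
  - exact: nq h2.
  - exact: le_trans hhe d1.
have -> : q1 - tau * q4 - rho * eg - (b - p * u * v / D1) =
    (q1 - b) - ((tau - tau0) * q4 + tau0 * (q4 - v)) - rho * eg.
  by rewrite /tau0; ring.
have -> : perturbation_modulus b1 p1 * delta =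
  delta + (2%:R * tau_modulus b1 p1 * delta * (b1 + 1) + p1 * b1 * delta)
  + 6%:R * (b1 + 1) * delta.
  by rewrite /perturbation_modulus; ring.
apply: ler_normB2; last exact: ler_normM.
apply: ler_normB2 => //.
apply: ler_normD2; last exact: ler_normM.
by apply: ler_normM => //; exact: nq h4.
Qed.

End Perturbation.

(** * Measurability of matrix functions *)

Section MatrixMeasurability.
Context {d} {T : measurableType d} {R : realType}.

Definition mx_measurable m n (F : T -> 'M[R]_(m, n)) :=
  forall i j, measurable_fun [set: T] (fun w => F w i j).

Lemma measurable_inv : measurable_fun [set: R] (@GRing.inv R).
Proof.
have -> : [set: R] = [set 0] `|` ~` [set 0] by rewrite setUv.
have o0 : open (~` [set (0 : R)]).
  by apply: closed_openC; exact: (@closed_eq R 0).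
apply/measurable_funU => //.
  exact: open_measurable.
split; first exact: measurable_fun_set1.
apply: open_continuous_measurable_fun => // x /set_mem /eqP x0.
exact: inv_continuous.
Qed.

Lemma measurable_funV (f : T -> R) : measurable_fun [set: T] f ->
  measurable_fun [set: T] (fun w => (f w)^-1).
Proof. by move=> mf; exact: (measurableT_comp measurable_inv mf). Qed.

Lemma mx_measurable_cst m n (A : 'M[R]_(m, n)) : mx_measurable (fun=> A).
Proof. by move=> i j; exact: measurable_cst. Qed.

Lemma mx_measurable_mul m n p (F : T -> 'M[R]_(m, n)) (G : T -> 'M[R]_(n, p)) :
  mx_measurable F -> mx_measurable G -> mx_measurable (fun w => F w *m G w).
Proof.
move=> mF mG i j; under eq_fun do rewrite mxE.
by apply: measurable_sum => l; exact: measurable_funM.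
Qed.

Lemma mx_measurableD m n (F G : T -> 'M[R]_(m, n)) :
  mx_measurable F -> mx_measurable G -> mx_measurable (fun w => F w + G w).
Proof.
by move=> mF mG i j; under eq_fun do rewrite mxE; exact: measurable_funD.
Qed.

Lemma mx_measurableN m n (F : T -> 'M[R]_(m, n)) :
  mx_measurable F -> mx_measurable (fun w => - F w).
Proof.
move=> mF i j; under eq_fun do rewrite mxE -mulN1r.
by apply: measurable_funM => //; exact: measurable_cst.
Qed.

Lemma mx_measurableB m n (F G : T -> 'M[R]_(m, n)) :
  mx_measurable F -> mx_measurable G -> mx_measurable (fun w => F w - G w).
Proof. by move=> mF mG; apply: mx_measurableD => //; exact: mx_measurableN. Qed.

Lemma mx_measurableZ m n (f : T -> R) (F : T -> 'M[R]_(m, n)) :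
  measurable_fun [set: T] f -> mx_measurable F -> mx_measurable (fun w => f w *: F w).
Proof.
by move=> mf mF i j; under eq_fun do rewrite mxE; exact: measurable_funM.
Qed.

Lemma mx_measurable_tr m n (F : T -> 'M[R]_(m, n)) :
  mx_measurable F -> mx_measurable (fun w => (F w)^T).
Proof. by move=> mF i j; under eq_fun do rewrite mxE; exact: mF. Qed.

Lemma measurable_det n (F : T -> 'M[R]_n) :
  mx_measurable F -> measurable_fun [set: T] (fun w => \det (F w)).
Proof.
move=> mF; rewrite /determinant; apply: measurable_sum => s.
apply: measurable_funM; first exact: measurable_cst.
by apply: measurable_prod => i _; exact: mF.
Qed.

Lemma measurable_trace n (F : T -> 'M[R]_n) :
  mx_measurable F -> measurable_fun [set: T] (fun w => \tr (F w)).
Proof. by move=> mF; apply: measurable_sum => i; exact: mF. Qed.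

(** [invmx] returns a singular matrix unchanged, so measurability is a case split on the
    determinant, with the cofactor formula where it is nonzero. *)
Lemma mx_measurable_inv n (F : T -> 'M[R]_n) :
  mx_measurable F -> mx_measurable (fun w => invmx (F w)).
Proof.
move=> mF i j.
have -> : (fun w => invmx (F w) i j) =
  (fun w => if \det (F w) == 0 then F w i j else (\det (F w))^-1 * cofactor (F w) j i).
  apply/funext => w; rewrite /invmx unitmxE unitfE; case: eqP => // _.
  by rewrite !mxE.
apply: measurable_fun_ifT => //.
  by apply: measurable_fun_eqr; [exact: measurable_det|exact: measurable_cst].
apply: measurable_funM; first by apply: measurable_funV; exact: measurable_det.
apply: measurable_funM; first exact: measurable_cst.
apply: measurable_det => a b; under eq_fun do rewrite !mxE.
exact: mF.
Qed.

Lemma measurable_dot n (u v : T -> 'cV[R]_n) :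
  mx_measurable u -> mx_measurable v -> measurable_fun [set: T] (fun w => dot (u w) (v w)).
Proof.
by move=> mu mv; apply: (mx_measurable_mul (mx_measurable_tr mu) mv).
Qed.

Lemma mx_measurable_residual_maker n k (X : T -> 'M[R]_(n, k)) (Q : T -> 'M[R]_n) :
  mx_measurable X -> mx_measurable Q -> mx_measurable (fun w => residual_maker (X w) (Q w)).
Proof.
move=> mX mQ; apply: mx_measurableB; first exact: mx_measurable_cst.
by do !(apply: mx_measurable_mul || apply: mx_measurable_inv || apply: mx_measurable_tr) => //.
Qed.

Lemma measurable_le_cst (f : T -> R) (k : R) : measurable_fun [set: T] f ->
  measurable [set w | f w <= k].
Proof.
move=> mf; have := mf measurableT _ (measurable_itv `]-oo, k]).
by rewrite setTI; congr measurable; apply/seteqP; split=> w /=; rewrite in_itv.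
Qed.

Lemma measurable_cst_le (f : T -> R) (k : R) : measurable_fun [set: T] f ->
  measurable [set w | k <= f w].
Proof.
move=> mf; have := mf measurableT _ (measurable_itv `[k, +oo[).
by rewrite setTI; congr measurable; apply/seteqP; split=> w /=; rewrite in_itv /= andbT.
Qed.

Lemma measurable_cst_lt (f : T -> R) (k : R) : measurable_fun [set: T] f ->
  measurable [set w | k < f w].
Proof.
move=> mf; have := mf measurableT _ (measurable_itv `]k, +oo[).
by rewrite setTI; congr measurable; apply/seteqP; split=> w /=; rewrite in_itv /= andbT.
Qed.

End MatrixMeasurability.

(** * From the operator norm to quadratic forms *)

Section OperatorNorm.
Context {R : realType} {n : nat}.
Implicit Types (G : 'M[R]_n) (v : 'cV[R]_n).

Lemma vnorm_sq v : vnorm v ^+ 2 = dot v v.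
Proof.
rewrite /vnorm sqr_sqrtr ?sumr_ge0// => [|i _]; last exact: sqr_ge0.
by rewrite dotE; apply: eq_bigr => i _; rewrite expr2.
Qed.

Lemma vnorm_ge0 v : 0 <= vnorm v.
Proof. exact: sqrtr_ge0. Qed.

Lemma vnormZ (a : R) v : vnorm (a *: v) = `|a| * vnorm v.
Proof.
rewrite /vnorm -sqrtr_sqr -sqrtrM ?sqr_ge0// mulr_sumr; congr Num.sqrt.
by apply: eq_bigr => i _; rewrite mxE exprMn.
Qed.

(** The Frobenius norm shows that the set whose supremum is [opnorm] is bounded above; without this
    [sup] would carry no information. *)
Lemma vnorm_mulmx_le G v :
  vnorm (G *m v) <= Num.sqrt (\sum_i dot (row i G)^T (row i G)^T) * vnorm v.
Proof.
have s0 : 0 <= \sum_i dot (row i G)^T (row i G)^T by rewrite sumr_ge0// => i _; exact: dot_ge0.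
rewrite /vnorm -sqrtrM// ler_wsqrtr// mulr_suml; apply: ler_sum => i _.
have -> : (G *m v) i 0 = dot (row i G)^T v.
  by rewrite dotE mxE; apply: eq_bigr => j _; rewrite !mxE.
apply: le_trans (dot_cauchy _ _) _; apply: ler_wpM2l; first exact: dot_ge0.
by rewrite dotE le_eqVlt; apply/orP; left; apply/eqP; apply: eq_bigr => j _; rewrite expr2.
Qed.

Lemma opnorm_le G v : vnorm (G *m v) <= opnorm G * vnorm v.
Proof.
have [v0|vn0] := eqVneq (vnorm v) 0.
  have -> : v = 0 by apply: dot_eq0; rewrite -vnorm_sq v0 expr0n.
  by rewrite mulmx0 -(scale0r 0) !vnormZ normr0 !mul0r mulr0.
have vp : 0 < vnorm v by rewrite lt_neqAle eq_sym vn0 vnorm_ge0.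
have u1 : vnorm ((vnorm v)^-1 *: v) = 1.
  by rewrite vnormZ ger0_norm ?invr_ge0 ?vnorm_ge0// mulVf.
rewrite -ler_pdivrMr// mulrC.
have -> : (vnorm v)^-1 * vnorm (G *m v) = vnorm (G *m ((vnorm v)^-1 *: v)).
  by rewrite -scalemxAr vnormZ ger0_norm// invr_ge0 vnorm_ge0.
apply: ub_le_sup; last by exists ((vnorm v)^-1 *: v).
exists (Num.sqrt (\sum_i dot (row i G)^T (row i G)^T)) => _ [u /= u1' <-].
by rewrite (le_trans (vnorm_mulmx_le _ _))// u1' mulr1.
Qed.

Lemma dot_le_vnorm u v : `|dot u v| <= vnorm u * vnorm v.
Proof.
rewrite -(ler_pXn2r (isT : (0 < 2)%N)) ?nnegrE ?mulr_ge0 ?vnorm_ge0//.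
by rewrite exprMn !vnorm_sq real_normK ?num_real// dot_cauchy.
Qed.

Lemma opnorm_coercive G (c : R) : opnorm G < 1 - c -> coercive c (1%:M - G).
Proof.
move=> hG v; rewrite mulmxBl mul1mx dotBr -vnorm_sq.
have h : dot v (G *m v) <= (1 - c) * vnorm v ^+ 2.
  apply: le_trans (ler_norm _) _; apply: le_trans (dot_le_vnorm _ _) _.
  rewrite expr2 mulrCA; apply: ler_wpM2l; first exact: vnorm_ge0.
  apply: le_trans (opnorm_le _ _) _; apply: ler_wpM2r; first exact: vnorm_ge0.
  exact: ltW.
by move: h; lra.
Qed.

(** The constant is (1 + 1)^2: since c is positive, G has norm below 1. *)
Lemma opnorm_sq_bounded G (c : R) : 0 < c -> opnorm G < 1 - c -> sq_bounded 4%:R (1%:M - G).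
Proof.
move=> c0 hG v; rewrite mulmxBl mul1mx.
have := dotD_sq_le v (- (G *m v)); rewrite dotNr dotNl opprK => /le_trans; apply.
have : vnorm (G *m v) <= vnorm v.
  apply: le_trans (opnorm_le _ _) _; rewrite ler_piMl ?vnorm_ge0//.
  by lra.
rewrite -(ler_pXn2r (isT : (0 < 2)%N)) ?nnegrE ?vnorm_ge0// !vnorm_sq.
by lra.
Qed.

End OperatorNorm.
(** * Conditionally i.i.d. variables *)

(* The conditioning sigma-algebra is that of the measurable map [pi]; it is later
   taken to be the identity onto the same set with a smaller sigma-algebra. *)
Section ConditionalIndependence.
Local Open Scope ereal_scope.
Context {d d'} {Om : measurableType d} {Om' : measurableType d'} {R : realType}.
Variables (P : probability Om R) (pi : Om -> Om') (N : nat) (e : 'I_N -> Om -> R).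
Variable mu : Om' -> probability R R.
Hypothesis mpi : measurable_fun [set: Om] pi.
Hypothesis me : forall i, measurable_fun [set: Om] (e i).
Hypothesis mmu : forall A, measurable A -> measurable_fun [set: Om'] (fun w => mu w A).
Hypothesis iid : forall H, measurable H ->
  forall A : 'I_N -> set R, (forall i, measurable (A i)) ->
  P (pi @^-1` H `&` \bigcap_(i in setT) (e i @^-1` A i)) =
  \int[P]_(w in pi @^-1` H) (\prod_(i < N) fine (mu (pi w) (A i)))%:E.

Lemma positive_functional_integral (m : probability R R) :
  positive_functional (fun f => \int[m]_y f y).
Proof.
split.
- by move=> f g [f0 mf] [g0 mg]; rewrite ge0_integralD.
- by move=> r f r0 [f0 mf]; rewrite ge0_integralZl_EFin.
- move=> g ng hg; rewrite monotone_convergence//.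
  + by move=> n; exact: (ng n).2.
  + by move=> n x _; exact: (ng n).1.
Qed.

Lemma nnmfun_integral (f : R -> \bar R) : nnmfun f ->
  nnmfun (fun w => \int[mu w]_y f y).
Proof.
move=> [f0 mf]; split; first by move=> w; exact: integral_ge0.
exact: measurable_fun_integral_kernel.
Qed.

(** Induction on the number k of factors that are allowed to be general while the others are
    indicators. For k = 0 the claim is the hypothesis on product events; each step frees one more
    factor by the extension principle. *)
Lemma expectation_prod_indic (H : set Om') (f : 'I_N -> R -> \bar R) :
  measurable H -> (forall i, nnmfun (f i)) ->
  \int[P]_w ((\1_H (pi w))%:E * \big[mule/1]_i f i (e i w)) =
  \int[P]_w ((\1_H (pi w))%:E * \big[mule/1]_i \int[mu (pi w)]_y f i y).
Proof.
move=> mH nf.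
have nH : nnmfun (fun w => (\1_H (pi w))%:E : \bar R).
  exact: (nnmfun_comp mpi (nnmfun_indic mH)).
suff G k : forall f : 'I_N -> R -> \bar R, (forall i, nnmfun (f i)) ->
    (forall i : 'I_N, (k <= i)%N -> exists2 A, measurable A & f i = fun x => (\1_A x)%:E) ->
    \int[P]_w ((\1_H (pi w))%:E * \big[mule/1]_i f i (e i w)) =
    \int[P]_w ((\1_H (pi w))%:E * \big[mule/1]_i \int[mu (pi w)]_y f i y).
  by apply: (G N) => // i; rewrite leqNgt ltn_ord.
elim: k => [|k IH] {}f {}nf hf.
  have /choice[A hA] : forall i, exists A, measurable A /\ f i = fun x => (\1_A x)%:E.
    by move=> i; have [//|A mA fA] := hf i; exists A.
  have mA i : measurable (A i) by case: (hA i).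
  have fA i : f i = fun x => (\1_(A i) x)%:E by case: (hA i).
  pose B := pi @^-1` H `&` \bigcap_(i in setT) (e i @^-1` A i).
  have mB : measurable B.
    apply: measurableI; first by rewrite -[X in measurable X]setTI; exact: mpi.
    apply: fin_bigcap_measurable => // i _.
    by rewrite -[X in measurable X]setTI; exact: me.
  transitivity (P B).
    have -> : P B = \int[P]_w (\1_B w)%:E by rewrite integral_indic// setIT.
    apply: eq_integral => w _.
    under eq_bigr => i _ do rewrite fA.
    rewrite -(big_morph EFin (@EFinM R) erefl) -EFinM; congr EFin.
    have [/set_mem [Hw Aw]|] := boolP (w \in B).
      rewrite !indicE mem_set// mem_set// mul1r big1// => i _.
      by rewrite indicE mem_set//; exact: Aw.
    rewrite [in RHS]indicE => nB; rewrite (negbTE nB).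
    have [Hw|Hw] := boolP (pi w \in H); last by rewrite indicE (negbTE Hw) mul0r.
    have /existsNP[i Ai] : ~ forall i, A i (e i w).
      move=> Aw; move/negP: nB; apply; apply/mem_set; split; first exact/set_mem.
      by move=> i _; exact: Aw.
    by rewrite (bigD1 i)//= [\1_(A i) _]indicE memNset// mul0r mulr0.
  rewrite iid// integral_mkcond; apply: eq_integral => w _.
  rewrite patchE.
  have [Hw|Hw] := boolP (pi w \in H); last first.
    by rewrite indicE (negbTE Hw) mul0e memNset// => Hw'; move/negP: Hw; apply; apply/mem_set.
  rewrite indicE Hw mul1e mem_set; last exact/set_mem.
  rewrite (big_morph EFin (@EFinM R) erefl); apply: eq_bigr => i _.
  by rewrite fA integral_indic// setIT fineK// fin_num_measure.
have [kN|Nk] := ltnP k N; last first.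
  by apply: IH => // i ki; have := leq_ltn_trans ki (ltn_ord i); rewrite ltnNge Nk.
pose i0 := Ordinal kN.
(* Both sides as functionals of the factor with index k alone; their agreement on indicators is the
   induction hypothesis. *)
pose L1 (g : R -> \bar R) :=
  \int[P]_w (((\1_H (pi w))%:E * \big[mule/1]_(i | i != i0) f i (e i w)) * g (e i0 w)).
pose L2 (g : R -> \bar R) :=
  \int[P]_w (((\1_H (pi w))%:E * \big[mule/1]_(i | i != i0) \int[mu (pi w)]_y f i y)
             * \int[mu (pi w)]_y g y).
have E1 (g : 'I_N -> R -> \bar R) : (forall i, i != i0 -> g i = f i) ->
    \int[P]_w ((\1_H (pi w))%:E * \big[mule/1]_i g i (e i w)) = L1 (g i0).
  move=> gf; apply: eq_integral => w _; rewrite (bigD1 i0)//= -muleA; congr (_ * _).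
  by rewrite muleC; congr (_ * _); apply: eq_bigr => i /gf ->.
have E2 (g : 'I_N -> R -> \bar R) : (forall i, i != i0 -> g i = f i) ->
    \int[P]_w ((\1_H (pi w))%:E * \big[mule/1]_i \int[mu (pi w)]_y g i y) = L2 (g i0).
  move=> gf; apply: eq_integral => w _; rewrite (bigD1 i0)//= -muleA; congr (_ * _).
  by rewrite muleC; congr (_ * _); apply: eq_bigr => i /gf ->.
rewrite E1// E2//.
apply: positive_functional_ext => //.
- apply: positive_functional_weight => //.
  + by apply: nnmfunM => //; apply: nnmfun_prod => i _; exact: nnmfun_comp.
  + by move=> g ng; exact: nnmfun_comp.
- apply: positive_functional_weight => //.
  + apply: nnmfunM => //; apply: nnmfun_prod => i _.
    exact: (nnmfun_comp mpi (nnmfun_integral (nf i))).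
  + by move=> g ng; exact: (nnmfun_comp mpi (nnmfun_integral ng)).
  + by move=> t; exact: positive_functional_integral.
  + move=> t g h [g0 mg] [h0 mh] gh; exact: ge0_le_integral.
move=> A mA.
pose g i := if i == i0 then (fun x => (\1_A x)%:E) else f i.
have gf i : i != i0 -> g i = f i by rewrite /g => /negbTE ->.
have -> : (fun x => (\1_A x)%:E) = g i0 by rewrite /g eqxx.
rewrite -E1// -E2//; apply: IH => i.
  by rewrite /g; case: ifP => // _; exact: nnmfun_indic.
rewrite /g; case: eqP => [_ _|/eqP ii0 ki]; first by exists A.
by apply: hf; rewrite ltn_neqAle ki andbT eq_sym.
Qed.

(** The extension principle once more, now in the weight, starting from indicators of conditioning
    events. *)
Lemma expectation_prod_nonneg (W : Om' -> \bar R) (f : 'I_N -> R -> \bar R) :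
  nnmfun W -> (forall i, nnmfun (f i)) ->
  \int[P]_w (W (pi w) * \big[mule/1]_i f i (e i w)) =
  \int[P]_w (W (pi w) * \big[mule/1]_i \int[mu (pi w)]_y f i y).
Proof.
move=> nW nf.
have n1 : nnmfun (fun w => \big[mule/1]_i f i (e i w)).
  by apply: nnmfun_prod => i _; exact: nnmfun_comp.
have n2 : nnmfun (fun w => \big[mule/1]_i \int[mu (pi w)]_y f i y).
  apply: nnmfun_prod => i _; exact: (nnmfun_comp mpi (nnmfun_integral (nf i))).
under eq_integral do rewrite muleC; under [RHS]eq_integral do rewrite muleC.
apply: (@positive_functional_ext _ _ _
  (fun W => \int[P]_w (\big[mule/1]_i f i (e i w) * W (pi w)))
  (fun W => \int[P]_w (\big[mule/1]_i (\int[mu (pi w)]_y f i y) * W (pi w)))) => //.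
- apply: positive_functional_weight => //.
  by move=> g ng; exact: nnmfun_comp.
- apply: positive_functional_weight => //.
  by move=> g ng; exact: nnmfun_comp.
move=> A mA.
under eq_integral do rewrite muleC; under [RHS]eq_integral do rewrite muleC.
exact: expectation_prod_indic.
Qed.


(** The bound M makes the kernel integrals finite, so [fine] loses nothing. It is asked for only
    where W is nonzero, because moments will be controlled on an event only. *)
Lemma expectation_prod_nonneg_real (W : Om' -> R) (f : 'I_N -> R -> R) (M : R) :
  measurable_fun [set: Om'] W -> (forall w, 0 <= W w)%R ->
  (forall i, measurable_fun [set: R] (f i)) -> (forall i y, 0 <= f i y)%R ->
  (forall w, W w != 0%R -> forall i, \int[mu w]_y (f i y)%:E <= M%:E) ->
  \int[P]_w (W (pi w) * \prod_i f i (e i w))%:E =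
  \int[P]_w (W (pi w) * \prod_i fine (\int[mu (pi w)]_y (f i y)%:E))%:E.
Proof.
move=> mW W0 mf f0 fM.
have := @expectation_prod_nonneg (EFin \o W) (fun i => EFin \o f i).
under eq_integral do rewrite -(big_morph EFin (@EFinM R) erefl).
rewrite (_ : (fun x => (EFin \o W) (pi x) * (\prod_i f i (e i x))%:E)
  = (fun w => (W (pi w) * \prod_i f i (e i w))%:E)); last by apply/funext => x; rewrite EFinM.
move=> ->; last 2 first.
- by split=> [w|]; [rewrite lee_fin | exact/measurable_EFinP].
- by move=> i; split=> [w|]; [rewrite lee_fin | exact/measurable_EFinP].
apply: eq_integral => w _ /=; rewrite EFinM.
have [->|Wn0] := eqVneq (W (pi w)) 0%R; first by rewrite !mul0e.
rewrite (big_morph EFin (@EFinM R) erefl); congr (_ * _); apply: eq_bigr => i _.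
rewrite fineK// ge0_fin_numE; last by apply: integral_ge0 => y _; rewrite lee_fin.
by apply: le_lt_trans (fM _ Wn0 i) _; rewrite ltry.
Qed.

Lemma measurable_prod_comp (f : 'I_N -> R -> R) :
  (forall i, measurable_fun [set: R] (f i)) ->
  measurable_fun [set: Om] (fun w => (\prod_i f i (e i w))%R).
Proof. by move=> mf; apply: measurable_prod => i _; exact: measurableT_comp. Qed.

Lemma measurable_fine_integral (f : R -> R) : measurable_fun [set: R] f ->
  measurable_fun [set: Om'] (fun w => fine (\int[mu w]_y (f y)%:E)).
Proof.
move=> mf; apply: measurableT_comp => //.
under eq_fun do rewrite integralE.
by apply: emeasurable_funB; apply: (nnmfun_integral _).2; split => //;
  [apply: measurable_funepos|apply: measurable_funeneg]; exact/measurable_EFinP.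
Qed.

Lemma integrable_prod (W : Om' -> R) (f : 'I_N -> R -> R) (BW M : R) :
  (0 <= M)%R -> measurable_fun [set: Om'] W -> (forall w, `|W w| <= BW)%R ->
  (forall i, measurable_fun [set: R] (f i)) ->
  (forall w, W w != 0%R -> forall i, \int[mu w]_y `|f i y|%:E <= M%:E) ->
  P.-integrable setT (fun w => (W (pi w) * \prod_i f i (e i w))%:E).
Proof.
move=> M0 mW WB mf fM; apply/integrableP; split.
  apply/measurable_EFinP; apply: measurable_funM; last exact: measurable_prod_comp.
  exact: measurableT_comp.
under eq_integral do rewrite abse_EFin normrM normr_prod.
rewrite (@expectation_prod_nonneg_real (fun w => `|W w|%R) (fun i y => `|f i y|%R) M)//.
- apply: (@le_lt_trans _ _ (\int[P]_w (BW * M ^+ N)%:E)); last first.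
    rewrite integral_cst//; set p := (X in _ * X).
    by rewrite (_ : p = 1) ?mule1 ?ltry//; exact: probability_setT.
  apply: ge0_le_integral => //.
  + by move=> w _; rewrite lee_fin mulr_ge0// prodr_ge0// => i _;
      rewrite fine_ge0// integral_ge0.
  + apply/measurable_EFinP; apply: measurable_funM.
      by apply: measurableT_comp => //; exact: measurableT_comp.
    apply: measurable_prod => i _.
    apply: (@measurableT_comp _ _ _ _ _ _ (fun w => fine (\int[mu w]_y `|f i y|%:E))) => //.
    by apply: measurable_fine_integral; exact: measurableT_comp.
  + move=> w _; rewrite lee_fin.
    have [->|Wn0] := eqVneq (W (pi w)) 0%R.
      rewrite normr0 mul0r mulr_ge0 ?exprn_ge0//.
      exact: le_trans (normr_ge0 _) (WB point).
    rewrite ler_pM//; first by rewrite prodr_ge0// => i _; rewrite fine_ge0// integral_ge0.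
    rewrite -[N in leRHS]card_ord -prodr_const ler_prod// => i _.
    rewrite fine_ge0 ?integral_ge0//=.
    by rewrite -lee_fin fineK ?fM// ge0_fin_numE ?integral_ge0// (le_lt_trans (fM _ Wn0 i))// ltry.
- exact: measurableT_comp.
- by move=> i; exact: measurableT_comp.
- by move=> w; rewrite normr_eq0; exact: fM.
Qed.

(* Reduces signed integrands to nonnegative ones: each factor is split into its
   positive and negative part and the product is expanded over sign patterns. *)
Lemma prod_signed (a : bool -> R) (x : 'I_N -> bool -> R) :
  ((\sum_(b : bool) (-1) ^+ b * a b) * \prod_i (\sum_(b : bool) (-1) ^+ b * x i b) =
  \sum_(q : bool * {ffun 'I_N -> bool})
    ((-1) ^+ q.1 * \prod_i (-1) ^+ (q.2 i)) * (a q.1 * \prod_i x i (q.2 i)))%R.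
Proof.
rewrite bigA_distr_bigA big_distrlr pair_big /=; apply: eq_bigr => -[b phi] _ /=.
by rewrite big_split/= mulrACA.
Qed.

(** The positive part for [false], the negative part for [true]. *)
Definition signpart (b : bool) (x : R) : R := (Num.max 0 ((-1) ^+ b * x))%R.

Lemma signpartE x : x = (\sum_(b : bool) (-1) ^+ b * signpart b x)%R.
Proof.
rewrite big_bool /= /signpart expr1 expr0 !mul1r !mulN1r.
by case: (leP 0%R x) => x0; case: leP; rewrite ?oppr_ge0 ?oppr_gt0; lra.
Qed.

Lemma signpart_ge0 b x : (0 <= signpart b x)%R.
Proof. by rewrite le_max lexx. Qed.

Lemma signpart_le b x : (signpart b x <= `|x|)%R.
Proof.
by rewrite /signpart ge_max normr_ge0 /=; case: b; rewrite ?expr1 ?mulN1r ?expr0 ?mul1r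
  ?ler_norm// -normrN ler_norm.
Qed.

Lemma measurable_signpart b d0 (T : measurableType d0) (f : T -> R) :
  measurable_fun [set: T] f -> measurable_fun [set: T] (fun x => signpart b (f x)).
Proof.
move=> mf; apply: measurable_maxr => //.
by apply: measurable_funM => //; exact: measurable_cst.
Qed.

Lemma expectation_prod (W : Om' -> R) (f : 'I_N -> R -> R) (BW M : R) :
  (0 <= M)%R -> measurable_fun [set: Om'] W -> (forall w, `|W w| <= BW)%R ->
  (forall i, measurable_fun [set: R] (f i)) ->
  (forall w, W w != 0%R -> forall i, \int[mu w]_y `|f i y|%:E <= M%:E) ->
  \int[P]_w (W (pi w) * \prod_i f i (e i w))%:E =
  \int[P]_w (W (pi w) * \prod_i fine (\int[mu (pi w)]_y (f i y)%:E))%:E.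
Proof.
move=> M0 mW WB mf fM.
have le_part b w : (`|signpart b (W w)| <= BW)%R.
  by rewrite ger0_norm ?signpart_ge0// (le_trans (signpart_le _ _)).
have partn0 b w : signpart b (W w) != 0%R -> W w != 0%R.
  by apply: contra_neq => ->; rewrite /signpart mulr0 maxxx.
have fpM w : W w != 0%R -> forall i b, \int[mu w]_y (signpart b (f i y))%:E <= M%:E.
  move=> Wn0 i b; apply: le_trans (fM w Wn0 i); apply: ge0_le_integral => //.
  - by move=> y _; rewrite lee_fin signpart_ge0.
  - by apply/measurable_EFinP; exact: measurable_signpart.
  - by apply/measurable_EFinP; exact: measurableT_comp.
  - by move=> y _; rewrite lee_fin signpart_le.
have meanE w : W w != 0%R -> forall i, fine (\int[mu w]_y (f i y)%:E) =
   (\sum_(b : bool) (-1) ^+ b * fine (\int[mu w]_y (signpart b (f i y))%:E))%R.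
  move=> Wn0 i; under eq_integral do rewrite [f i _]signpartE.
  have fin b : \int[mu w]_y (signpart b (f i y))%:E \is a fin_num.
    rewrite ge0_fin_numE; first exact: le_lt_trans (fpM _ Wn0 i b) (ltry _).
    by apply: integral_ge0 => y _; rewrite lee_fin signpart_ge0.
  rewrite integral_lin; last first.
    move=> b; apply/integrableP; split.
      by apply/measurable_EFinP; exact: measurable_signpart.
    under eq_integral do rewrite /= ger0_norm ?signpart_ge0//.
    exact: le_lt_trans (fpM _ Wn0 i b) (ltry _).
  rewrite -[RHS]/(fine (_%:E)) -sumEFin; congr fine; apply: eq_bigr => b _.
  by rewrite EFinM fineK.
pose c (q : bool * {ffun 'I_N -> bool}) : R := ((-1) ^+ q.1 * \prod_i (-1) ^+ (q.2 i))%R.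
transitivity (\int[P]_w (\sum_q c q *
    (signpart q.1 (W (pi w)) * \prod_i signpart (q.2 i) (f i (e i w))))%:E).
  apply: eq_integral => w _; rewrite /c -(prod_signed (fun b => signpart b (W (pi w)))
    (fun i b => signpart b (f i (e i w)))) -signpartE; congr (_ * _)%:E.
  by apply: eq_bigr => i _; exact: signpartE.
rewrite integral_lin; last first.
  move=> q; apply: (@integrable_prod (fun w => signpart q.1 (W w))
    (fun i x => signpart (q.2 i) (f i x)) BW M) => //.
  - exact: measurable_signpart.
  - by move=> i; exact: measurable_signpart.
  - move=> w /partn0 Wn0 i; under eq_integral do rewrite ger0_norm ?signpart_ge0//.
    exact: fpM.
transitivity (\int[P]_w (\sum_q c q * (signpart q.1 (W (pi w)) *
    \prod_i fine (\int[mu (pi w)]_y (signpart (q.2 i) (f i y))%:E)))%:E); last first.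
  apply: eq_integral => w _.
  have [W0|Wn0] := eqVneq (W (pi w)) 0%R.
    by rewrite W0 mul0r big1// => q _; rewrite /signpart mulr0 maxxx mul0r mulr0.
  rewrite /c -(prod_signed (fun b => signpart b (W (pi w)))
    (fun i b => fine (\int[mu (pi w)]_y (signpart b (f i y))%:E))).
  rewrite -signpartE; congr (_ * _)%:E; apply: eq_bigr => i _.
  by rewrite meanE.
rewrite integral_lin; last first.
  move=> q; apply: (@integrable_bounded _ _ _ _ _ (BW * M ^+ N)).
    apply: measurable_funM.
      by apply: (@measurableT_comp _ _ _ _ _ _ (fun w => signpart q.1 (W w))) => //;
        exact: measurable_signpart.
    apply: measurable_prod => i _.
    apply: (@measurableT_comp _ _ _ _ _ _
      (fun w => fine (\int[mu w]_y (signpart (q.2 i) (f i y))%:E))) => //.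
    by apply: measurable_fine_integral; exact: measurable_signpart.
  move=> w; have [W0|Wn0] := eqVneq (W (pi w)) 0%R.
    rewrite W0 /signpart mulr0 maxxx mul0r normr0 mulr_ge0 ?exprn_ge0//.
    exact: le_trans (normr_ge0 _) (WB point).
  rewrite normrM ler_pM//.
  rewrite normr_prod -[N in leRHS]card_ord -prodr_const ler_prod// => i _.
  rewrite normr_ge0 /= ger0_norm; last first.
    by rewrite fine_ge0// integral_ge0// => y _; rewrite lee_fin signpart_ge0.
  rewrite -lee_fin fineK ?fpM// ge0_fin_numE.
    exact: le_lt_trans (fpM _ Wn0 i _) (ltry _).
  by apply: integral_ge0 => y _; rewrite lee_fin signpart_ge0.
apply: eq_bigr => q _; congr (_ * _).
apply: (@expectation_prod_nonneg_real (fun w => signpart q.1 (W w))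
   (fun i x => signpart (q.2 i) (f i x)) M).
- exact: measurable_signpart.
- by move=> w; exact: signpart_ge0.
- by move=> i; exact: measurable_signpart.
- by move=> i y; exact: signpart_ge0.
- by move=> w /partn0 Wn0 i; exact: fpM.
Qed.


Definition moment (p : nat) (w : Om') : R := fine (\int[mu w]_y (y ^+ p)%:E).

Variables (E : set Om') (C : R).
Hypothesis mE : measurable E.
Hypothesis C0 : (0 < C)%R.
Hypothesis mean0 : forall w, E w -> \int[mu w]_y y%:E = 0.
Hypothesis var_bound : forall w, E w -> \int[mu w]_y (y ^+ 2)%:E <= C%:E.
Hypothesis moment4_bound : forall w, E w -> \int[mu w]_y (y ^+ 4)%:E <= C%:E.

Lemma measurable_moment p : measurable_fun [set: Om'] (moment p).
Proof. by apply: measurable_fine_integral; exact: measurable_funX. Qed.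

(** From |y|^p <= 1 + y^4 for p <= 4, so one constant serves all moments in use. *)
Lemma abs_moment_bound w p : E w -> (p <= 4)%N ->
  \int[mu w]_y `|y ^+ p|%:E <= (1 + C)%:E.
Proof.
move=> Ew p4; apply: (@le_trans _ _ (\int[mu w]_y (1 + (y ^+ 4)%:E))).
  apply: ge0_le_integral => //.
  - by apply/measurable_EFinP; apply: measurableT_comp => //; exact: measurable_funX.
  - by apply: emeasurable_funD => //; apply/measurable_EFinP; exact: measurable_funX.
  - move=> y _; rewrite -EFinD lee_fin normrX.
    have -> : (y ^+ 4 = `|y| ^+ 4)%R by rewrite -normrX ger0_norm// exprn_even_ge0.
    have [y1|y1] := leP `|y|%R 1%R.
      by rewrite (le_trans (exprn_ile1 p (normr_ge0 y) y1))// lerDl exprn_ge0.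
    rewrite (le_trans (_ : _ <= `|y| ^+ 4)%R) ?lerDr//.
    by rewrite ler_weXn2l// ltW.
rewrite ge0_integralD//.
- rewrite integral_cst//; set q := (X in 1 * X + _).
  rewrite (_ : q = 1) ?mule1; last exact: probability_setT.
  by rewrite EFinD leeD2l// moment4_bound.
- by move=> y _; rewrite lee_fin exprn_even_ge0.
- by apply/measurable_EFinP; exact: measurable_funX.
Qed.

Lemma moment_bound w p : E w -> (p <= 4)%N -> (`|moment p w| <= 1 + C)%R.
Proof.
move=> Ew p4; rewrite -lee_fin; apply: le_trans (abs_moment_bound Ew p4).
have mf : measurable_fun [set: R] (fun y : R => (y ^+ p)%:E).
  by apply/measurable_EFinP; exact: measurable_funX.
apply: le_trans (le_abse_integral (mu w) measurableT mf).
rewrite /moment; case: (\int[mu w]_y _) => [r| |] //=.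
- by rewrite normr0 leey.
- by rewrite normr0 leey.
Qed.

Lemma moment_eval w : E w -> [/\ moment 0 w = 1, moment 1 w = 0,
  0 <= moment 2 w <= C & moment 4 w <= C]%R.
Proof.
move=> Ew; split.
- rewrite /moment; under eq_integral do rewrite expr0.
  rewrite integral_cst// mul1e; set q := (X in fine X).
  by rewrite (_ : q = 1)//; exact: probability_setT.
- by rewrite /moment; under eq_integral do rewrite expr1; rewrite mean0.
- have i0 : 0 <= \int[mu w]_y (y ^+ 2)%:E.
    by apply: integral_ge0 => y _; rewrite lee_fin sqr_ge0.
  rewrite fine_ge0//= -lee_fin fineK ?var_bound// ge0_fin_numE//.
  exact: le_lt_trans (var_bound Ew) (ltry _).
- have i0 : 0 <= \int[mu w]_y (y ^+ 4)%:E.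
    by apply: integral_ge0 => y _; rewrite lee_fin exprn_even_ge0.
  rewrite -lee_fin fineK ?moment4_bound// ge0_fin_numE//.
  exact: le_lt_trans (moment4_bound Ew) (ltry _).
Qed.

(** Vanishing off E lets moment bounds that are assumed on E suffice under an integral over the
    whole space. *)
Definition weight (BW : R) (W : Om' -> R) := [/\ measurable_fun [set: Om'] W,
  forall w, (`|W w| <= BW)%R & forall w, ~ E w -> W w = 0%R].

Lemma weight_supp BW W w : weight BW W -> W w != 0%R -> E w.
Proof. by move=> [_ _ W0]; apply: contra_neqP => /W0. Qed.

(** Conditional independence enters the variance computations through these monomials; exponents up
    to 4 are enough for the square of a quadratic form. *)
Lemma same_mean_monomial (BW : R) (W : Om' -> R) (p : 'I_N -> nat) :
  weight BW W -> (forall i, p i <= 4)%N ->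
  same_mean P (fun w => W (pi w) * \prod_i e i w ^+ p i)%R
    (fun w => W (pi w) * \prod_i moment (p i) (pi w))%R.
Proof.
move=> wW p4; have [mW WB W0] := wW.
have C1 : (0 <= 1 + C)%R by rewrite addr_ge0// ltW.
have mX i : measurable_fun [set: R] (fun y : R => y ^+ p i)%R by exact: measurable_funX.
have bd w : W w != 0%R -> forall i, \int[mu w]_y `|y ^+ p i|%:E <= (1 + C)%:E.
  by move=> /(weight_supp wW) Ew i; exact: abs_moment_bound.
split.
- exact: (integrable_prod C1 mW WB mX bd).
- apply: (@integrable_bounded _ _ _ _ _ (BW * (1 + C) ^+ N)%R).
    apply: measurable_funM; first exact: measurableT_comp.
    by apply: measurable_prod => i _; exact: (measurableT_comp (measurable_moment (p i))).
  move=> w; rewrite normrM.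
  have [->|Wn0] := eqVneq (W (pi w)) 0%R.
    rewrite normr0 mul0r mulr_ge0 ?exprn_ge0//.
    exact: le_trans (normr_ge0 _) (WB point).
  rewrite ler_pM// normr_prod -[N in leRHS]card_ord -prodr_const ler_prod// => i _.
  by rewrite normr_ge0 moment_bound//; exact: weight_supp Wn0.
- exact: (expectation_prod C1 mW WB mX bd).
Qed.

Lemma same_mean_mul2 BW W (a b : 'I_N) : weight BW W ->
  same_mean P (fun w => W (pi w) * (e a w * e b w))%R
    (fun w => W (pi w) * ((a == b)%:R * moment 2 (pi w)))%R.
Proof.
move=> wW; have p4 (i : 'I_N) : ((i == a) + (i == b) <= 4)%N.
  by case: (i == a); case: (i == b).
have := same_mean_monomial wW p4.
congr same_mean; apply/funext => w.
  by under eq_bigr do rewrite exprD; rewrite big_split/= !prod_expr_eq.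
have [W0|Wn0] := eqVneq (W (pi w)) 0%R; first by rewrite W0 !mul0r.
have [m0 m1 _ _] := moment_eval (weight_supp wW Wn0).
by rewrite -(prod_moment2 (m := fun p => moment p (pi w))).
Qed.

Lemma same_mean_mul4 BW W (a b c k : 'I_N) : weight BW W ->
  same_mean P (fun w => W (pi w) * (e a w * e b w * e c w * e k w))%R
    (fun w => W (pi w) * (moment 2 (pi w) ^+ 2 * ((a == b)%:R * (c == k)%:R
      + (a == c)%:R * (b == k)%:R + (a == k)%:R * (b == c)%:R)
  + (moment 4 (pi w) - 3%:R * moment 2 (pi w) ^+ 2) *
    ((a == b)%:R * (a == c)%:R * (a == k)%:R)))%R.
Proof.
move=> wW; have p4 (i : 'I_N) : ((i == a) + (i == b) + (i == c) + (i == k) <= 4)%N.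
  by case: (i == a); case: (i == b); case: (i == c); case: (i == k).
have := same_mean_monomial wW p4.
congr same_mean; apply/funext => w.
  by under eq_bigr do rewrite !exprD; rewrite !big_split/= !prod_expr_eq.
have [W0|Wn0] := eqVneq (W (pi w)) 0%R; first by rewrite W0 !mul0r.
have [m0 m1 _ _] := moment_eval (weight_supp wW Wn0).
by rewrite -(prod_moment4 (m := fun p => moment p (pi w))).
Qed.


Lemma weight_restrict (BW : R) (f : Om' -> R) : (0 <= BW)%R ->
  measurable_fun [set: Om'] f -> (forall w, E w -> `|f w| <= BW)%R ->
  weight BW (fun w => \1_E w * f w)%R.
Proof.
move=> BW0 mf fB; split.
- by apply: measurable_funM => //; exact: measurable_indic.
- move=> w; rewrite indicE; have [/set_mem Ew|_] := boolP (w \in E).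
    by rewrite mul1r fB.
  by rewrite mul0r normr0.
- by move=> w nE; rewrite indicE memNset// mul0r.
Qed.

Lemma same_mean_weight BW W : weight BW W ->
  same_mean P (fun w => W (pi w)) (fun w => W (pi w)).
Proof.
move=> [mW WB _]; suff h : P.-integrable setT (EFin \o (fun w => W (pi w))) by [].
apply: (@integrable_bounded _ _ _ _ _ BW) => //.
exact: measurableT_comp.
Qed.

Local Notation s2 w := (moment 2 w).

(** The square is expanded into weights times monomials of degree 4, 2 and 0. Replacing each
    monomial by its conditional mean leaves an integrand bounded pointwise by
    [quadratic_variance_le]. *)
Lemma quadratic_form_second_moment (B : Om' -> 'I_N -> 'I_N -> R) (F : R) :
  (forall a b, measurable_fun [set: Om'] (fun w => B w a b)) ->
  (forall w, E w -> (\sum_(p : 'I_N * 'I_N) B w p.1 p.2 ^+ 2 <= F)%R) -> (0 <= F)%R ->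
  \int[P]_w (\1_E (pi w) * (\sum_(p : 'I_N * 'I_N) B (pi w) p.1 p.2 *
     (e p.1 w * e p.2 w - (p.1 == p.2)%:R * s2 (pi w))) ^+ 2)%:E
  <= ((2%:R * C ^+ 2 + C) * F)%:E.
Proof.
move=> mB BF F0.
pose I := ('I_N * 'I_N)%type.
(* A crude bound whose value does not reach the conclusion; it only makes the weights bounded, hence
   the terms integrable. *)
have Bb w (p : I) : E w -> (`|B w p.1 p.2| <= 1 + F)%R.
  move=> /BF; rewrite (bigD1 p)//= => h.
  have : (B w p.1 p.2 ^+ 2 <= F)%R.
    by apply: le_trans h; rewrite lerDl sumr_ge0// => q _; exact: sqr_ge0.
  rewrite -real_normK ?num_real// => h2.
  have [b1|b1] := leP `|B w p.1 p.2|%R 1%R; first by rewrite (le_trans b1)// lerDl.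
  apply: (@le_trans _ _ (`|B w p.1 p.2| ^+ 2)%R); last by rewrite (le_trans h2)// lerDr.
  by rewrite expr2 ler_peMr// ltW.
have sC w : E w -> (`|s2 w| <= C)%R.
  by move=> /moment_eval[_ _ /andP[h0 hC] _]; rewrite ger0_norm.
have F1 : (0 <= 1 + F)%R by rewrite addr_ge0.
pose BB (p q : I) w : R := (B w p.1 p.2 * B w q.1 q.2)%R.
have mBB p q : measurable_fun [set: Om'] (BB p q) by exact: measurable_funM.
have BBb p q w : E w -> (`|BB p q w| <= (1 + F) ^+ 2)%R.
  by move=> Ew; rewrite normrM expr2 ler_pM// Bb.
have w4 p q : weight ((1 + F) ^+ 2)%R (fun w => \1_E w * BB p q w)%R.
  by apply: weight_restrict; rewrite ?exprn_ge0//; exact: BBb.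
have w2 p q (k : bool) : weight ((1 + F) ^+ 2 * C)%R
    (fun w => \1_E w * (k%:R * BB p q w * s2 w))%R.
  apply: weight_restrict; first by rewrite mulr_ge0 ?exprn_ge0// ltW.
    apply: measurable_funM; last exact: measurable_moment.
    by apply: measurable_funM => //; exact: measurable_cst.
  move=> w Ew; rewrite !normrM ler_pM ?mulr_ge0 ?sC// -normrM.
  by case: k; rewrite ?normr1 ?normr0 ?mul1r ?mul0r ?exprn_ge0// BBb.
have w0 p q (k : bool) : weight ((1 + F) ^+ 2 * C * C)%R
    (fun w => \1_E w * (k%:R * BB p q w * s2 w * s2 w))%R.
  apply: weight_restrict; first by rewrite !mulr_ge0 ?exprn_ge0// ltW.
    apply: measurable_funM; last exact: measurable_moment.
    apply: measurable_funM; last exact: measurable_moment.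
    by apply: measurable_funM => //; exact: measurable_cst.
  move=> w Ew; rewrite !normrM ler_pM ?mulr_ge0 ?sC// ler_pM ?mulr_ge0 ?sC// -normrM.
  by case: k; rewrite ?normr1 ?normr0 ?mul1r ?mul0r ?exprn_ge0// BBb.
have term (p q : I) := same_meanD (same_meanD (same_meanD
  (same_mean_mul4 p.1 p.2 q.1 q.2 (w4 p q))
  (same_meanN (same_mean_mul2 q.1 q.2 (w2 p q (p.1 == p.2)))))
  (same_meanN (same_mean_mul2 p.1 p.2 (w2 p q (q.1 == q.2)))))
  (same_mean_weight (w0 p q ((p.1 == p.2) && (q.1 == q.2)))).
have := same_mean_sum (fun p => same_mean_sum (term p)).
move=> [iX iZ XZ].
have -> : \int[P]_w (\1_E (pi w) * (\sum_(p : I) B (pi w) p.1 p.2 *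
     (e p.1 w * e p.2 w - (p.1 == p.2)%:R * s2 (pi w))) ^+ 2)%:E =
   \int[P]_w (\sum_(i : I) \sum_(i0 : I)
          (\1_E (pi w) * BB i i0 (pi w) *
           (e i.1 w * e i.2 w * e i0.1 w * e i0.2 w) +
           - (\1_E (pi w) * ((i.1 == i.2)%:R * BB i i0 (pi w) * moment 2 (pi w)) *
              (e i0.1 w * e i0.2 w)) +
           - (\1_E (pi w) * ((i0.1 == i0.2)%:R * BB i i0 (pi w) * moment 2 (pi w)) *
              (e i.1 w * e i.2 w)) +
           \1_E (pi w) * (((i.1 == i.2) && (i0.1 == i0.2))%:R * BB i i0 (pi w) *
            moment 2 (pi w) * moment 2 (pi w)))%R)%:E.
  apply: eq_integral => w _; congr EFin.
  rewrite expr2 big_distrlr/= mulr_sumr; apply: eq_bigr => p _.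
  rewrite mulr_sumr; apply: eq_bigr => q _.
  by rewrite /BB -mulnb natrM; ring.
rewrite XZ.
apply: (@le_trans _ _ (\int[P]_w ((2%:R * C ^+ 2 + C) * F)%:E)); last first.
  rewrite integral_cst//; set x := (X in _ * X).
  by rewrite (_ : x = 1) ?mule1//; exact: probability_setT.
apply: le_integral => //.
  apply: (@integrable_bounded _ _ _ _ (fun=> ((2%:R * C ^+ 2 + C) * F)%R)) => //.
move=> w _; rewrite lee_fin.
have [/set_mem Ew|nE] := boolP (pi w \in E); last first.
  rewrite big1 ?mulr_ge0// ?addr_ge0 ?mulr_ge0 ?sqr_ge0 ?ltW// => p _.
  by rewrite big1// => q _; rewrite indicE (negbTE nE) /= mulr0n !mul0r ?oppr0 ?addr0.
have [_ _ s0C m4C] := moment_eval Ew.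
apply: le_trans (quadratic_variance_le s0C m4C C0 (BF _ Ew)).
rewrite le_eqVlt; apply/orP; left; apply/eqP.
apply: eq_bigr => p _; apply: eq_bigr => q _.
by rewrite indicE mem_set// /BB -mulnb natrM /= mulr1n; ring.
Qed.

Lemma measurable_preimage_pi (A : set Om') : measurable A -> measurable (pi @^-1` A).
Proof. by move=> mA; rewrite -[X in measurable X]setTI; exact: mpi. Qed.

Lemma quadratic_form_chebyshev (B : Om' -> 'I_N -> 'I_N -> R) (F t : R) :
  (forall a b, measurable_fun [set: Om'] (fun w => B w a b)) ->
  (forall w, E w -> (\sum_(p : 'I_N * 'I_N) B w p.1 p.2 ^+ 2 <= F)%R) -> (0 <= F)%R ->
  (0 < t)%R ->
  P (pi @^-1` E `&` [set w | (t < `|\sum_(p : 'I_N * 'I_N) B (pi w) p.1 p.2 *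
     (e p.1 w * e p.2 w - (p.1 == p.2)%:R * s2 (pi w))|)%R])
  <= ((2%:R * C ^+ 2 + C) * F / t ^+ 2)%:E.
Proof.
move=> mB BF F0 t0.
apply: chebyshev_on => //.
- exact: measurable_preimage_pi.
- apply: measurable_sum => p; apply: measurable_funM.
    exact: (measurableT_comp (mB p.1 p.2)).
  apply: measurable_funB; first exact: measurable_funM.
  apply: measurable_funM; first exact: measurable_cst.
  exact: (measurableT_comp (measurable_moment 2)).
- exact: quadratic_form_second_moment.
Qed.

Lemma linear_form_chebyshev (h : Om' -> 'I_N -> R) (F t : R) :
  (forall a, measurable_fun [set: Om'] (fun w => h w a)) ->
  (forall w, E w -> (\sum_a h w a ^+ 2 <= F)%R) -> (0 <= F)%R -> (0 < t)%R ->
  P (pi @^-1` E `&` [set w | (t < `|\sum_a h (pi w) a * e a w|)%R])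
  <= (C * F / t ^+ 2)%:E.
Proof.
move=> mh hF F0 t0.
apply: chebyshev_on => //.
- exact: measurable_preimage_pi.
- apply: measurable_sum => a; apply: measurable_funM => //.
  exact: (measurableT_comp (mh a)).
have hb w a : E w -> (`|h w a| <= 1 + F)%R.
  move=> /hF; rewrite (bigD1 a)//= => hh.
  have : (h w a ^+ 2 <= F)%R.
    by apply: le_trans hh; rewrite lerDl sumr_ge0// => q _; exact: sqr_ge0.
  rewrite -real_normK ?num_real// => h2.
  have [b1|b1] := leP `|h w a|%R 1%R; first by rewrite (le_trans b1)// lerDl.
  apply: (@le_trans _ _ (`|h w a| ^+ 2)%R); last by rewrite (le_trans h2)// lerDr.
  by rewrite expr2 ler_peMr// ltW.
have F1 : (0 <= 1 + F)%R by rewrite addr_ge0.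
have w2 a b : weight ((1 + F) ^+ 2)%R (fun w => \1_E w * (h w a * h w b))%R.
  apply: weight_restrict; rewrite ?exprn_ge0//; first exact: measurable_funM.
  by move=> w Ew; rewrite normrM expr2 ler_pM// hb.
have [iX iZ XZ] := same_mean_sum (fun a => same_mean_sum (fun b => same_mean_mul2 a b (w2 a b))).
have -> : \int[P]_w (\1_(pi @^-1` E) w * (\sum_a h (pi w) a * e a w) ^+ 2)%:E =
   \int[P]_w (\sum_a \sum_b \1_E (pi w) * (h (pi w) a * h (pi w) b) * (e a w * e b w))%R%:E.
  apply: eq_integral => w _; congr EFin.
  rewrite expr2 big_distrlr/= mulr_sumr; apply: eq_bigr => a _.
  by rewrite mulr_sumr; apply: eq_bigr => b _; rewrite !indicE; ring.
rewrite XZ.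
apply: (@le_trans _ _ (\int[P]_w (C * F)%:E)); last first.
  rewrite integral_cst//; set x := (X in _ * X).
  by rewrite (_ : x = 1) ?mule1//; exact: probability_setT.
apply: le_integral => //.
  by apply: (@integrable_bounded _ _ _ _ (fun=> C * F)%R).
move=> w _; rewrite lee_fin.
have [/set_mem Ew|nE] := boolP (pi w \in E); last first.
  rewrite big1 ?mulr_ge0// ?ltW// => a _.
  by rewrite big1// => b _; rewrite indicE (negbTE nE) /= mulr0n !mul0r ?oppr0 ?addr0.
have [_ _ /andP[s0 sC] _] := moment_eval Ew.
apply: (@le_trans _ _ (s2 (pi w) * \sum_a h (pi w) a ^+ 2)%R).
  rewrite le_eqVlt; apply/orP; left; apply/eqP.
  rewrite mulr_sumr; apply: eq_bigr => a _.
  rewrite (bigD1 a)//= big1 ?addr0.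
    by rewrite eqxx indicE mem_set//= !mulr1n; ring.
  by move=> b ba; rewrite eq_sym (negbTE ba) /= mulr0n mul0r mulr0.
by apply: ler_pM => //; [rewrite sumr_ge0// => a _; exact: sqr_ge0|exact: hF].
Qed.


Section EmbeddedForms.
Variables (n : nat) (sg sg' : 'I_n -> 'I_N).
Hypotheses (inj_sg : injective sg) (inj_sg' : injective sg').

Definition subsample (f : 'I_n -> 'I_N) (w : Om) : 'cV[R]_n := (\col_i e (f i) w)%R.

Lemma quadratic_form_subsample (A : Om' -> 'M[R]_n) (F t : R) :
  (forall i j, measurable_fun [set: Om'] (fun w => A w i j)) ->
  (forall w, E w -> (\sum_i \sum_j A w i j ^+ 2 <= F)%R) -> (0 <= F)%R -> (0 < t)%R ->
  P (pi @^-1` E `&` [set w | (t < `|dot (subsample sg w) (A (pi w) *m subsample sg' w)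
     - s2 (pi w) * \sum_i \sum_j A (pi w) i j * (sg i == sg' j)%:R|)%R])
  <= ((2%:R * C ^+ 2 + C) * F / t ^+ 2)%:E.
Proof.
move=> mA AF F0 t0.
have formE w : (\sum_(p : 'I_N * 'I_N) embed_mx sg sg' (A (pi w)) p.1 p.2 *
     (e p.1 w * e p.2 w - (p.1 == p.2)%:R * s2 (pi w)) =
   dot (subsample sg w) (A (pi w) *m subsample sg' w)
     - s2 (pi w) * \sum_i \sum_j A (pi w) i j * (sg i == sg' j)%:R)%R.
  rewrite (sum_embed_mx sg sg' (A (pi w))
    (fun a b => e a w * e b w - (a == b)%:R * s2 (pi w))%R).
  rewrite dotE mulr_sumr -sumrB; apply: eq_bigr => i _.
  rewrite !mxE !mulr_sumr -sumrB; apply: eq_bigr => j _; rewrite !mxE; ring.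
under eq_fun do rewrite -formE.
apply: (@quadratic_form_chebyshev (fun w => embed_mx sg sg' (A w)) F t) => //.
- move=> a b; apply: measurable_sum => i; apply: measurable_sum => j.
  by apply: measurable_funM => //; exact: measurable_cst.
- by move=> w Ew; rewrite sum_embed_mx_sq// AF.
Qed.

Lemma linear_form_subsample (h : Om' -> 'cV[R]_n) (F t : R) :
  (forall i j, measurable_fun [set: Om'] (fun w => h w i j)) ->
  (forall w, E w -> (dot (h w) (h w) <= F)%R) -> (0 <= F)%R -> (0 < t)%R ->
  P (pi @^-1` E `&` [set w | (t < `|dot (h (pi w)) (subsample sg w)|)%R])
  <= (C * F / t ^+ 2)%:E.
Proof.
move=> mh hF F0 t0.
have formE w : dot (h (pi w)) (subsample sg w) = (\sum_a embed_vec sg (h (pi w)) a * e a w)%R.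
  rewrite (sum_embed_vec sg (h (pi w)) (fun a => e a w)) dotE.
  by apply: eq_bigr => i _; rewrite mxE.
under eq_fun do rewrite formE.
apply: (@linear_form_chebyshev (fun w => embed_vec sg (h w)) F t) => //.
- move=> a; apply: measurable_sum => i.
  by apply: measurable_funM => //; exact: measurable_cst.
- move=> w Ew; rewrite sum_embed_vec_sq//.
  by have := hF w Ew; rewrite dotE; under eq_bigr do rewrite -expr2.
Qed.

End EmbeddedForms.

End ConditionalIndependence.

(** * The error on the regular event *)

Section DeterministicBound.
Context {R : realType} {n k : nat}.
Variables (Xt : 'M[R]_(n, k)) (G : 'M[R]_n) (alpha : 'cV[R]_k).
Let Q := 1%:M - G.
Let A := Q *m MG Xt G.
Let s := dot alpha (invmx (gram Xt Q) *m alpha).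
Let g := Q *m Xt *m (invmx (gram Xt Q) *m alpha).
Let h := Q^T *m Xt *m (invmx (gram Xt Q^T) *m alpha).

(** Divided by n, the forms become the arguments of [variance_ratio_perturbation] with p = n s. The
    limit b = s2 tr A / n is at least c a0, and dividing by b produces the denominator of the
    bound. *)
Lemma ratio_bound (beta : 'cV[R]_k) (e l : 'cV[R]_n) (s2 c C a0 a1 p1 delta : R) :
  (0 < n)%N -> gram Xt Q \in unitmx -> 0 < c -> c <= s2 <= C -> 0 < a0 ->
  a0 * n%:R <= \tr A <= a1 * n%:R ->
  `|\tr ((lagD R n)^T *m A)| <= a1 * n%:R -> `|\tr (lagD R n *m A)| <= a1 * n%:R ->
  0 <= s <= p1 / n%:R ->
  0 <= delta <= 1 -> (3%:R + p1) * delta <= 1 / 2%:R ->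
  `|dot e (A *m e) - s2 * \tr A| <= delta * n%:R ->
  `|dot l (A *m l) - s2 * \tr A| <= delta * n%:R ->
  `|dot l (A *m e) - s2 * \tr ((lagD R n)^T *m A)| <= delta * n%:R ->
  `|dot e (A *m l) - s2 * \tr (lagD R n *m A)| <= delta * n%:R ->
  `|dot h e| <= delta -> `|dot h l| <= delta -> `|dot e g| <= delta -> `|dot l g| <= delta ->
  `|sigma_hat Xt (Xt + l *m alpha^T) ((Xt + l *m alpha^T) *m beta + e) G / s2
    - rhs_limit Xt G alpha s2| <= perturbation_modulus (C * a1) p1 * delta / (c * a0).
Proof.
move=> n0 uS c0 /andP[cs sC] a00 /andP[ta0 ta1] tu tv /andP[s0 sp] hd hd2 h1 h2 h3 h4 hhe hhl heg hlg.
have nR : 0 < n%:R :> R by rewrite ltr0n.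
have nN0 : n%:R != 0 :> R by rewrite gt_eqF.
have s2p : 0 < s2 by exact: lt_le_trans cs.
have C0 : 0 <= C by rewrite ltW// (lt_le_trans s2p).
have tp : 0 < \tr A by apply: lt_le_trans ta0; rewrite mulr_gt0.
pose sc (x : R) := x / n%:R.
have scb x y d : `|x - s2 * y| <= d * n%:R -> `|sc x - s2 * sc y| <= d.
  by move=> hx; rewrite /sc mulrA -mulrBl normrM normfV (ger0_norm (ltW nR)) ler_pdivrMr.
have s2sc y : `|y| <= a1 * n%:R -> `|s2 * sc y| <= C * a1.
  move=> hy; apply: ler_normM; first by rewrite ger0_norm// ltW.
  by rewrite /sc normrM normfV (ger0_norm (ltW nR)) ler_pdivrMr.
set b := s2 * sc (\tr A); set u := s2 * sc (\tr ((lagD R n)^T *m A)).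
set v := s2 * sc (\tr (lagD R n *m A)).
have bge : c * a0 <= b.
  by apply: ler_pM => //; [exact: ltW|exact: ltW|rewrite /sc ler_pdivlMr].
have ca0 : 0 < c * a0 by rewrite mulr_gt0.
have bp : 0 < b by exact: lt_le_trans bge.
have bC : b <= C * a1.
  by apply: le_trans (ler_norm _) (s2sc _ _); rewrite ger0_norm// ltW.
pose p := s * n%:R.
have hp : 0 <= p <= p1.
  by rewrite /p mulr_ge0 ?ler0n// -ler_pdivlMr.
have [|DD key] := @variance_ratio_perturbation R b (C * a1) p p1 u v delta
  (sc (dot e (A *m e))) (sc (dot l (A *m l))) (sc (dot l (A *m e))) (sc (dot e (A *m l)))
  (dot h e) (dot h l) (dot e g) (dot l g) _ hp (s2sc _ tu) (s2sc _ tv) hd hd2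
  (scb _ _ _ h1) (scb _ _ _ h2) (scb _ _ _ h3) (scb _ _ _ h4) hhe hhl heg hlg.
  by rewrite (ltW bp).
have psc x : p * sc x = s * x by rewrite /p /sc -mulrA; congr (_ * _); rewrite mulrCA divff// mulr1.
rewrite psc in DD key.
have D0 : (1 + dot l g) * (1 + dot h l) + s * dot l (A *m l) != 0.
  by rewrite gt_eqF// (lt_le_trans _ DD)//; lra.
set y := _ *m beta + e; set X1 := Xt + l *m alpha^T.
have num : (y^T *m (1%:M - G) *m MG X1 G *m y) 0 0 = dot y (Q *m residual_maker X1 Q *m y).
  by rewrite /dot !mulmxA.
rewrite /sigma_hat num (residual_quadratic_update uS D0).
have TmKE : TmK Xt G = \tr A by [].
have p1b : 0 < 1 + p * b.
  by have /andP[pp _] := hp; rewrite ltr_wpDr ?mulr_ge0// ltW.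
have rhs : rhs_limit Xt G alpha s2 = (b - p * u * v / (1 + p * b)) / b.
  have pbE : 1 + s2 * \tr A * s = 1 + p * b.
    by rewrite /b mulrCA psc; ring.
  rewrite /rhs_limit /Sbar TmKE -[_ 0 0]/((alpha^T *m _ *m alpha) 0 0) -mulmxA -/(dot _ _).
  rewrite (sherman_morrison_quadratic uS); last by rewrite pbE gt_eqF.
  rewrite pbE -/Q -!mulmxA -/A -/s.
  rewrite mulrBl divff ?gt_eqF//; congr (1 - _).
  move: (1 + p * b) p1b => w p1b.
  rewrite /u /v /b /p /sc.
  by field; rewrite nN0 !gt_eqF.
rewrite rhs.
have -> : forall x z : R, x / TmK Xt G / s2 - z / b = (sc x - z) / b.
  move=> x z; rewrite TmKE mulrBl; congr (_ - _); rewrite /sc /b.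
  by rewrite /sc; field; rewrite nN0 !gt_eqF.
rewrite normrM normfV (gtr0_norm bp).
have bi0 : 0 <= b^-1 by rewrite invr_ge0 ltW.
apply: ler_pM => //; last by rewrite lef_pV2.
apply: le_trans key; rewrite le_eqVlt; apply/orP; left; apply/eqP; congr (`|_ - _|).
rewrite /sc -/A -/s -/g -/h psc.
move: (_ + s * dot l (A *m l)) D0 => De De0.
by field; rewrite nN0 De0.
Qed.

End DeterministicBound.

(** * Lag traces from the overlap of current and lagged errors *)

Section LagTraces.
Context {R : realType} {n : nat}.
Variable A : 'M[R]_n.

Definition current (i : 'I_n) : 'I_n.+1 := lift ord0 i.
Definition lagged (i : 'I_n) : 'I_n.+1 := widen_ord (leqnSn n) i.

Lemma current_inj : injective current. Proof. exact: lift_inj. Qed.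

Lemma lagged_inj : injective lagged.
Proof. by move=> i j /(congr1 val) /= ij; exact: val_inj. Qed.

Lemma sum_diag_trace (f : 'I_n -> 'I_n.+1) : injective f ->
  \sum_i \sum_j A i j * (f i == f j)%:R = \tr A.
Proof.
move=> fI; apply: eq_bigr => i _; rewrite (bigD1 i)//= eqxx mulr1 big1 ?addr0// => j ji.
by rewrite (inj_eq fI) eq_sym (negbTE ji) mulr0.
Qed.

(** Among errors numbered from 0, the i-th current one has number i + 1 and the j-th lagged one has
    number j. They coincide when j = i + 1, which is where D has its ones; hence e'Al has
    conditional mean s2 tr(D A). *)
Lemma sum_current_lagged :
  \sum_i \sum_j A i j * (current i == lagged j)%:R = \tr (lagD R n *m A).
Proof.
rewrite exchange_big; apply: eq_bigr => j _; rewrite mxE; apply: eq_bigr => i _.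
rewrite mxE mulrC; congr (_%:R * _); congr nat_of_bool.
by rewrite -val_eqE /= /bump /= add1n eq_sym.
Qed.

Lemma sum_lagged_current :
  \sum_i \sum_j A i j * (lagged i == current j)%:R = \tr ((lagD R n)^T *m A).
Proof.
rewrite exchange_big; apply: eq_bigr => j _; rewrite mxE; apply: eq_bigr => i _.
rewrite !mxE mulrC; congr (_%:R * _); congr nat_of_bool.
Qed.

(** A row or column of D has at most one nonzero entry, so a diagonal entry of D A or D'A is an
    entry of A or 0. *)
Lemma sum_atmost1_le (P : pred 'I_n) (f : 'I_n -> R) (a : R) : 0 <= a ->
  (forall i j, P i -> P j -> i = j) -> (forall i, `|f i| <= a) ->
  `|\sum_i (P i)%:R * f i| <= a.
Proof.
move=> a0 P1 fa; case: (pickP P) => [i Pi|P0]; last first.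
  by rewrite big1 ?normr0// => i _; rewrite P0 mul0r.
rewrite (bigD1 i)//= Pi mul1r big1 ?addr0// => j ji.
have [Pj|] := boolP (P j); last by rewrite mul0r.
by rewrite (P1 _ _ Pj Pi) eqxx in ji.
Qed.

Lemma trace_le (B : 'M[R]_n) (a : R) : (forall i, `|B i i| <= a) -> `|\tr B| <= a * n%:R.
Proof.
move=> Ba; apply: le_trans (ler_norm_sum _ _ _) _.
have -> : a * n%:R = \sum_(i < n) a by rewrite sumr_const card_ord mulr_natr.
exact: ler_sum.
Qed.

Lemma lag_trace_le (a : R) : 0 <= a -> (forall i j, `|A i j| <= a) ->
  `|\tr (lagD R n *m A)| <= a * n%:R /\ `|\tr ((lagD R n)^T *m A)| <= a * n%:R.
Proof.
move=> a0 Aa; split; apply: trace_le => i; rewrite mxE.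
- under eq_bigr do rewrite mxE.
  apply: (@sum_atmost1_le (fun j => (i : nat) == j.+1)) => // j j' /eqP ij /eqP ij'.
  by apply: val_inj; move: ij'; rewrite ij => -[].
- under eq_bigr do rewrite !mxE.
  apply: (@sum_atmost1_le (fun j => (j : nat) == i.+1)) => // j j' /eqP ij /eqP ij'.
  by apply: val_inj; rewrite /= ij ij'.
Qed.

End LagTraces.

(** * Bounds on the design *)

Section Design.
Context {R : realType} {n k : nat}.
Variables (cK cG M : R).
Variable alpha : 'cV[R]_k.
Hypothesis cG0 : 0 < cG.

(* Consequences of the assumptions on the design that are visibly measurable, unlike
   the bound on [opnorm], a supremum over an uncountable set.  Positivity of the
   squared determinant says that the Gram matrix is invertible. *)
Definition design_bounds (Xt : 'M[R]_(n, k)) (Q : 'M[R]_n) :=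
  let A := Q *m residual_maker Xt Q in
  let s := dot alpha (invmx (gram Xt Q) *m alpha) in
  let g := Q *m Xt *m (invmx (gram Xt Q) *m alpha) in
  let h := Q^T *m Xt *m (invmx (gram Xt Q^T) *m alpha) in
  (0 < \det (gram Xt Q) ^+ 2 /\ cG * cK * n%:R <= \tr A) /\
  (\tr A <= 4%:R / cG * n%:R /\ `|\tr ((lagD R n)^T *m A)| <= 4%:R / cG * n%:R) /\
  (`|\tr (lagD R n *m A)| <= 4%:R / cG * n%:R /\
   \sum_i \sum_j A i j ^+ 2 <= 16%:R / cG ^+ 2 * n%:R) /\
  (0 <= s /\ s <= M / cG / n%:R) /\
  (dot g g <= 4%:R * M / cG ^+ 2 / n%:R /\ dot h h <= 4%:R * M / cG ^+ 2 / n%:R).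

Lemma design_bounds_unit Xt Q : design_bounds Xt Q -> gram Xt Q \in unitmx.
Proof.
case=> [[d0 _] _]; rewrite unitmxE unitfE; apply: contraTneq d0 => ->.
by rewrite expr0n ltxx.
Qed.

(** The vector h is the g of Q', so coercivity, the norm bound and invertibility are first carried
    over to Q'. The lower bound on the trace uses n - k >= cK n. *)
Lemma design_bounds_hold (Xt : 'M[R]_(n, k)) (Q : 'M[R]_n) : (0 < n)%N ->
  \rank Xt = k -> k%:R / n%:R < 1 - cK -> coercive cG Q -> sq_bounded 4%:R Q ->
  `|(alpha^T *m invmx ((n%:R)^-1 *: (Xt^T *m Xt)) *m alpha) 0 0| <= M ->
  design_bounds Xt Q.
Proof.
move=> n0 rX kn cQ bQ kM.
have nR : 0 < n%:R :> R by rewrite ltr0n.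
have nN0 : n%:R != 0 :> R by rewrite gt_eqF.
have uS := gram_unit cG0 cQ rX.
have cQt := coercive_tr cQ.
have bQt : sq_bounded 4%:R Q^T by exact: sq_bounded_tr.
have uSt := gram_unit cG0 cQt rX.
(* The hypothesis has X'X normalized by 1 / n; undoing this turns the bound M into M / n. *)
have kapE : dot alpha (invmx (Xt^T *m Xt) *m alpha) <= M / n%:R.
  rewrite ler_pdivlMr//; apply: le_trans kM; apply: le_trans (ler_norm _).
  rewrite invmxZ; last by rewrite unitmxZ ?gram1_unit// unitfE invr_eq0.
  by rewrite invrK -scalemxAr -scalemxAl mxE /dot mulmxA mulrC.
have le1 (B : 'M[R]_n) : (forall i j, `|B i j| <= 4%:R / cG) -> \tr B <= 4%:R / cG * n%:R.
  by move=> hB; apply: le_trans (ler_norm _) _; exact: trace_le.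
have a10 : 0 <= 4%:R / cG by rewrite divr_ge0// ltW.
have hA i j : `|(Q *m residual_maker Xt Q) i j| <= 4%:R / cG.
  exact: A_entry_le.
have [tD tDt] := lag_trace_le a10 hA.
split; [split|split; [split|split; [split|split; split]]] => //.
- by move: uS; rewrite unitmxE unitfE exprn_even_gt0.
- apply: le_trans (trace_residual_ge cG0 cQ uS); rewrite -mulrA ler_pM2l//.
  by move: kn; rewrite ltr_pdivrMr//; lra.
- exact: le1 hA.
- exact: A_sum_sq_le.
- exact: (gram_inv_ge0 cG0 cQ uS).
- apply: le_trans (gram_inv_le cG0 cQ uS alpha rX) _.
  by rewrite mulrAC ler_pM2r// invr_gt0.
- apply: le_trans (g_sq_le cG0 cQ uS bQ alpha rX) _.
  rewrite [leRHS](_ : _ = 4%:R * (M / n%:R) / cG ^+ 2); last by ring.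
  by rewrite ler_pM2r ?invr_gt0 ?exprn_gt0// ler_pM2l.
- apply: le_trans (g_sq_le cG0 cQt uSt bQt alpha rX) _.
  rewrite [leRHS](_ : _ = 4%:R * (M / n%:R) / cG ^+ 2); last by ring.
  by rewrite ler_pM2r ?invr_gt0 ?exprn_gt0// ler_pM2l.
Qed.

Section DesignMeasurability.
Context {d} {T : measurableType d}.
Variables (Xt : T -> 'M[R]_(n, k)) (Q : T -> 'M[R]_n).
Hypotheses (mX : mx_measurable Xt) (mQ : mx_measurable Q).

Lemma mx_measurable_gram : mx_measurable (fun w => gram (Xt w) (Q w)).
Proof.
by do !(apply: mx_measurable_mul || apply: mx_measurable_inv || apply: mx_measurable_tr) => //.
Qed.

Lemma mx_measurable_Qresidual :
  mx_measurable (fun w => Q w *m residual_maker (Xt w) (Q w)).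
Proof. by apply: mx_measurable_mul => //; exact: mx_measurable_residual_maker. Qed.

Lemma mx_measurable_gram_inv :
  mx_measurable (fun w => invmx (gram (Xt w) (Q w)) *m alpha).
Proof.
apply: mx_measurable_mul; last exact: mx_measurable_cst.
by apply: mx_measurable_inv; exact: mx_measurable_gram.
Qed.

Lemma mx_measurable_loading :
  mx_measurable (fun w => Q w *m Xt w *m (invmx (gram (Xt w) (Q w)) *m alpha)).
Proof.
by apply: mx_measurable_mul; [exact: mx_measurable_mul|exact: mx_measurable_gram_inv].
Qed.

End DesignMeasurability.

Lemma measurable_design_bounds d (T : measurableType d)
    (Xt : T -> 'M[R]_(n, k)) (Q : T -> 'M[R]_n) :
  mx_measurable Xt -> mx_measurable Q -> measurable [set w | design_bounds (Xt w) (Q w)].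
Proof.
move=> mX mQ; have mA := mx_measurable_Qresidual mX mQ.
have mg := mx_measurable_loading mX mQ.
have mh := mx_measurable_loading mX (mx_measurable_tr mQ).
have ms := measurable_dot (mx_measurable_cst alpha) (mx_measurable_gram_inv mX mQ).
rewrite /design_bounds.
do !apply: measurableI.
- apply: measurable_cst_lt; apply: measurable_funX; apply: measurable_det.
  exact: mx_measurable_gram.
- exact: (measurable_cst_le _ (measurable_trace mA)).
- exact: (measurable_le_cst _ (measurable_trace mA)).
- apply: measurable_le_cst; apply: measurableT_comp => //; apply: measurable_trace.
  by apply: mx_measurable_mul => //; exact: mx_measurable_cst.
- apply: measurable_le_cst; apply: measurableT_comp => //; apply: measurable_trace.
  by apply: mx_measurable_mul => //; exact: mx_measurable_cst.
- apply: measurable_le_cst; apply: measurable_sum => i; apply: measurable_sum => j.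
  by apply: measurable_funX; exact: mA.
- exact: measurable_cst_le.
- exact: measurable_le_cst.
- by apply: measurable_le_cst; exact: measurable_dot.
- by apply: measurable_le_cst; exact: measurable_dot.
Qed.

End Design.

(** * Tail of the error *)

Section SmallEvents.
Context {d} {T : measurableType d} {R : realType}.
Variable P : probability T R.
Implicit Types A B : set T.

Lemma ae_le_measure A B : measurable A -> measurable B ->
  {ae P, forall w, A w -> B w} -> (P A <= P B)%E.
Proof.
move=> mA mB [N [mN N0 AN]].
apply: (@le_trans _ _ (P (B `|` N))).
  apply: le_measure; rewrite ?inE//; first exact: measurableU.
  move=> w Aw; have [Bw|nB] := pselect (B w); first by left.
  by right; apply: AN => /= h; apply: nB; exact: h.
apply: le_trans (measureU2 _ mB mN) _.
rewrite -[leRHS]adde0; apply: leeD => //.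
by rewrite le_eqVlt; apply/orP; left; apply/eqP; exact: N0.
Qed.

Definition event_le A (a : R) := measurable A /\ (P A <= a%:E)%E.

Lemma event_leU A B a b : event_le A a -> event_le B b -> event_le (A `|` B) (a + b).
Proof.
move=> [mA PA] [mB PB]; split; first exact: measurableU.
by rewrite EFinD; apply: le_trans (measureU2 _ mA mB) _; exact: leeD.
Qed.

End SmallEvents.

Section FixedSample.
Context {R : realType} {d} {Om : measurableType d}.
Variables (P : probability Om R) (n k : nat) (c C cG : R).
Variables (Xt : Om -> 'M[R]_(n, k)) (eps : Om -> 'I_n.+1 -> R) (mu : Om -> probability R R).
Variables (alpha beta : 'cV[R]_k) (Gam : Om -> 'M[R]_n).
Hypotheses (n0 : (0 < n)%N) (c0 : 0 < c) (C0 : 0 < C) (cG0 : 0 < cG).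
Hypothesis HX : forall i j, measurable_fun setT (fun w => Xt w i j).
Hypothesis Hrank : {ae P, forall w, \rank (Xt w) = k}.
Hypothesis He : forall i, measurable_fun setT (fun w => eps w i).
Hypothesis Hiid : cond_iid P (sigma_gen Xt) (fun i w => eps w i) mu.
Hypothesis Hmean : {ae P, forall w, (\int[mu w]_y y%:E = 0)%E}.
Hypothesis Hvar : {ae P, forall w, (c%:E < \int[mu w]_y (y ^+ 2)%:E < C%:E)%E}.
Hypothesis H4 : {ae P, forall w, (\int[mu w]_y (y ^+ 4)%:E < C%:E)%E}.
Hypothesis HK : k%:R / n%:R < 1 - c.
Hypothesis HG : forall i j, measurable_wrt (sigma_gen Xt) (fun w => Gam w i j).
Hypothesis HGn : {ae P, forall w, opnorm (Gam w) < 1 - cG}.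

Definition design_generators := [set A : set Om | exists i j (B : set R),
  measurable B /\ A = (fun w => Xt w i j) @^-1` B].

Let Om' := g_sigma_algebraType design_generators.
Let toG : Om -> Om' := id.

Lemma measurable_toG : measurable_fun [set: Om] toG.
Proof.
move=> _ A mA; rewrite setTI.
have : <<s design_generators >> `<=` @measurable d Om.
  apply: smallest_sub; first exact: sigma_algebra_measurable.
  move=> _ [i [j [B [mB ->]]]].
  by rewrite -[X in measurable X]setTI; exact: HX.
exact.
Qed.

Lemma measurable_from_design (f : Om' -> R) :
  measurable_fun [set: Om'] f -> measurable_fun [set: Om] (f : Om -> R).
Proof.
move=> mf _ B mB.
have := measurable_toG measurableT (mf measurableT B mB).
by rewrite !setTI.
Qed.

Lemma measurable_wrt_design (Z : Om -> R) :
  measurable_wrt (sigma_gen Xt) Z -> measurable_fun [set: Om'] (Z : Om' -> R).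
Proof. by move=> mZ _ B mB; rewrite setTI; exact: mZ. Qed.

Lemma mx_measurable_Xt : mx_measurable (Xt : Om' -> _).
Proof.
move=> i j; apply: measurable_wrt_design => B mB.
by apply: sub_sigma_algebra; exists i, j, B.
Qed.

Let Q (w : Om') := 1%:M - Gam w.

Lemma mx_measurable_Q : mx_measurable Q.
Proof.
apply: mx_measurableB; first exact: mx_measurable_cst.
by move=> i j; exact: measurable_wrt_design.
Qed.

Lemma measurable_mu (A : set R) : measurable A ->
  measurable_fun [set: Om'] (fun w : Om' => mu w A).
Proof.
move=> mA; have [h _] := Hiid.
have -> : (fun w : Om' => mu w A) = EFin \o (fun w : Om' => fine (mu w A)).
  by apply/funext => w /=; rewrite fineK// fin_num_measure.
by apply/measurable_EFinP; apply: measurable_wrt_design; exact: h.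
Qed.

Lemma measurable_mu_integral (f : R -> R) : measurable_fun [set: R] f ->
  measurable_fun [set: Om'] (fun w : Om' => \int[mu w]_y (f y)%:E)%E.
Proof.
move=> mf; under eq_fun do rewrite integralE.
apply: emeasurable_funB; apply: measurable_fun_integral_kernel => //.
- exact: measurable_mu.
- by apply: measurable_funepos; exact/measurable_EFinP.
- exact: measurable_mu.
- by apply: measurable_funeneg; exact/measurable_EFinP.
Qed.

Variable M : R.
Hypothesis M0 : 0 < M.

(** This event plays the role of E in the conditional moment bounds, where its indicator is a
    weight; it must therefore be measurable for the sigma-algebra of X~ and not merely for the
    ambient one. *)
Definition regular_event : set Om' := [set w : Om' |
  (\int[mu w]_y y%:E = 0)%E /\ (c%:E <= \int[mu w]_y (y ^+ 2)%:E)%E /\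
  (\int[mu w]_y (y ^+ 2)%:E <= C%:E)%E /\ (\int[mu w]_y (y ^+ 4)%:E <= C%:E)%E /\
  design_bounds c cG M alpha (Xt w) (Q w)].

Lemma measurable_regular_event : measurable regular_event.
Proof.
have m1 := measurable_mu_integral (@measurable_id _ _ setT).
have m2 := measurable_mu_integral (measurable_funX 2 (@measurable_id _ _ setT)).
have m4 := measurable_mu_integral (measurable_funX 4 (@measurable_id _ _ setT)).
have le (f : Om' -> \bar R) (x : \bar R) : measurable_fun [set: Om'] f -> measurable [set w | (f w <= x)%E].
  move=> mf; rewrite -[X in measurable X]setTI.
  by apply: emeasurable_fun_infty_c.
rewrite /regular_event; apply: measurableI.
  by rewrite -[X in measurable X]setTI; exact: (m1 measurableT [set 0%E]).
apply: measurableI.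
  by rewrite -[X in measurable X]setTI; apply: emeasurable_fun_c_infty.
apply: measurableI; first exact: le.
apply: measurableI; first exact: le.
exact: measurable_design_bounds mx_measurable_Xt mx_measurable_Q.
Qed.

Let kappa w := (alpha^T *m invmx ((n%:R)^-1 *: ((Xt w)^T *m Xt w)) *m alpha) 0 0.

Lemma measurable_kappa : measurable_fun [set: Om] kappa.
Proof.
have mX : mx_measurable Xt by exact: HX.
have h : mx_measurable (fun w => alpha^T *m invmx ((n%:R)^-1 *: ((Xt w)^T *m Xt w)) *m alpha).
  apply: mx_measurable_mul; last exact: mx_measurable_cst.
  apply: mx_measurable_mul; first exact: mx_measurable_cst.
  apply: mx_measurable_inv; apply: mx_measurableZ; first exact: measurable_cst.
  by apply: mx_measurable_mul => //; exact: mx_measurable_tr.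
exact: h.
Qed.

(** Rank, moments and operator norm behave almost surely, so up to a null set regularity can fail
    only where kappa exceeds M. *)
Lemma regular_event_tail :
  (P (~` (toG @^-1` regular_event)) <= P [set w | (M < `|kappa w|)%R])%E.
Proof.
apply: ae_le_measure.
- apply: measurableC; rewrite -[X in measurable X]setTI.
  by apply: measurable_toG => //; exact: measurable_regular_event.
- apply: measurable_cst_lt; apply: measurableT_comp => //; exact: measurable_kappa.
apply: (@filterS _ (almost_everywhere P) _ _ _ _
  (filterI Hrank (filterI Hmean (filterI Hvar (filterI H4 HGn))))) => w [rX [hm [/andP[hv1 hv2] [h4 hG]]]] nE.
rewrite /= ltNge; apply/negP => kM; apply: nE.
split=> //; split; first exact: ltW.
split; first exact: ltW.
split; first exact: ltW.
apply: design_bounds_hold => //; first exact: opnorm_coercive.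
exact: opnorm_sq_bounded hG.
Qed.

Definition cur w : 'cV[R]_n := \col_i eps w (lift ord0 i).
Definition lag w : 'cV[R]_n := \col_i eps w (widen_ord (leqnSn n) i).

Lemma mx_measurable_cur : mx_measurable cur.
Proof. by move=> i j; under eq_fun do rewrite mxE; exact: He. Qed.

Lemma mx_measurable_lag : mx_measurable lag.
Proof. by move=> i j; under eq_fun do rewrite mxE; exact: He. Qed.

Let A w := Q w *m residual_maker (Xt w) (Q w).
Let g w := Q w *m Xt w *m (invmx (gram (Xt w) (Q w)) *m alpha).
Let h w := (Q w)^T *m Xt w *m (invmx (gram (Xt w) (Q w)^T) *m alpha).
Let s2 w := cond_var (mu w).

Let error w := sigma_hat (Xt w) (model_X (Xt w) (eps w) alpha)
               (model_y (Xt w) (eps w) alpha beta) (Gam w) / s2 w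
       - rhs_limit (Xt w) (Gam w) alpha (s2 w).

(** This constant and the next are what Chebyshev leaves over delta^2 n: for quadratic forms at
    level delta n, with squared Frobenius norm at most 16 n / cG^2, and for linear forms at level
    delta, with squared length at most 4 M / (cG^2 n). *)
Definition quadratic_tail := (2%:R * C ^+ 2 + C) * (16%:R / cG ^+ 2).
Definition linear_tail := C * (4%:R * M / cG ^+ 2).

Lemma iid_toG (H : set Om') : measurable H ->
  forall B : 'I_n.+1 -> set R, (forall i, measurable (B i)) ->
  (P (toG @^-1` H `&` \bigcap_(i in setT) ((fun w => eps w i) @^-1` B i)) =
  \int[P]_(w in toG @^-1` H) (\prod_(i < n.+1) fine (mu (toG w) (B i)))%:E)%E.
Proof. by case: Hiid => _ iid mH B mB; exact: iid. Qed.

Variable delta : R.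
Hypothesis delta0 : 0 < delta.

Lemma quadratic_event (sg sg' : 'I_n -> 'I_n.+1) : injective sg -> injective sg' ->
  event_le P (toG @^-1` regular_event `&` [set w | (delta * n%:R <
    `|dot (\col_i eps w (sg i)) (A w *m \col_i eps w (sg' i))
      - s2 w * \sum_i \sum_j A w i j * (sg i == sg' j)%:R|)%R])
  (quadratic_tail / delta ^+ 2 / n%:R).
Proof.
move=> isg isg'; have nR : 0 < n%:R :> R by rewrite ltr0n.
have mA := mx_measurable_Qresidual mx_measurable_Xt mx_measurable_Q.
split.
  apply: measurableI.
    rewrite -[X in measurable X]setTI.
    by apply: measurable_toG => //; exact: measurable_regular_event.
  apply: measurable_cst_lt; apply: measurableT_comp => //.
  have mAO : mx_measurable (A : Om -> 'M[R]_n) by move=> i j; exact: (measurable_from_design (mA i j)).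
  apply: measurable_funB.
    apply: measurable_dot; first by move=> i j; under eq_fun do rewrite mxE; exact: He.
    apply: mx_measurable_mul => //.
    by move=> i j; under eq_fun do rewrite mxE; exact: He.
  apply: measurable_funM.
    apply: (@measurable_from_design (fun w : Om' => cond_var (mu w))).
    apply: measurableT_comp => //.
    by apply: measurable_mu_integral; exact: measurable_funX.
  apply: measurable_sum => i; apply: measurable_sum => j.
  by apply: measurable_funM => //; exact: measurable_cst.
have q0 : 0 <= 16%:R / cG ^+ 2 * n%:R by rewrite mulr_ge0// divr_ge0// exprn_ge0// ltW.
have dn : 0 < delta * n%:R by rewrite mulr_gt0.
have := @quadratic_form_subsample _ _ Om Om' R P toG _ (fun i w => eps w i) mu
  measurable_toG He measurable_mu iid_toG regular_event C measurable_regular_event C0.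
move=> /(_ _ _ _ n sg sg' isg isg' (fun w : Om' => Q w *m residual_maker (Xt w) (Q w)) _ _ mA _ q0 dn) H.
apply: le_trans (H _ _ _ _) _.
- by move=> w [].
- by move=> w [_ [_ []]].
- by move=> w [_ [_ [_ []]]].
- by move=> w [_ [_ [_ [_ [_ [_ [[]]]]]]]].
rewrite lee_fin le_eqVlt; apply/orP; left; apply/eqP.
by rewrite /quadratic_tail; field; rewrite !gt_eqF.
Qed.

Lemma linear_event (sg : 'I_n -> 'I_n.+1) (hv : Om' -> 'cV[R]_n) : injective sg ->
  mx_measurable hv ->
  (forall w, regular_event w -> dot (hv w) (hv w) <= 4%:R * M / cG ^+ 2 / n%:R) ->
  event_le P (toG @^-1` regular_event `&`
    [set w | (delta < `|dot (hv w) (\col_i eps w (sg i))|)%R])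
  (linear_tail / delta ^+ 2 / n%:R).
Proof.
move=> isg mh hF; have nR : 0 < n%:R :> R by rewrite ltr0n.
split.
  apply: measurableI.
    rewrite -[X in measurable X]setTI.
    by apply: measurable_toG => //; exact: measurable_regular_event.
  apply: measurable_cst_lt; apply: measurableT_comp => //.
  apply: measurable_dot; first by move=> i j; exact: (measurable_from_design (mh i j)).
  by move=> i j; under eq_fun do rewrite mxE; exact: He.
have q0 : 0 <= 4%:R * M / cG ^+ 2 / n%:R.
  by rewrite !divr_ge0 ?mulr_ge0 ?exprn_ge0// ltW.
have := @linear_form_subsample _ _ Om Om' R P toG _ (fun i w => eps w i) mu
  measurable_toG He measurable_mu iid_toG regular_event C measurable_regular_event C0.
move=> /(_ _ _ _ n sg isg hv _ _ mh hF q0 delta0) H.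
apply: le_trans (H _ _ _) _.
- by move=> w [].
- by move=> w [_ [_ []]].
- by move=> w [_ [_ [_ []]]].
rewrite lee_fin le_eqVlt; apply/orP; left; apply/eqP.
by rewrite /linear_tail; field; rewrite !gt_eqF.
Qed.


Hypothesis delta1 : delta <= 1.
Hypothesis delta_half : (3%:R + M / cG) * delta <= 1 / 2%:R.

Lemma error_le w : regular_event w ->
  `|dot (cur w) (A w *m cur w) - s2 w * \tr (A w)| <= delta * n%:R ->
  `|dot (lag w) (A w *m lag w) - s2 w * \tr (A w)| <= delta * n%:R ->
  `|dot (lag w) (A w *m cur w) - s2 w * \tr ((lagD R n)^T *m A w)| <= delta * n%:R ->
  `|dot (cur w) (A w *m lag w) - s2 w * \tr (lagD R n *m A w)| <= delta * n%:R ->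
  `|dot (h w) (cur w)| <= delta -> `|dot (h w) (lag w)| <= delta ->
  `|dot (g w) (cur w)| <= delta -> `|dot (g w) (lag w)| <= delta ->
  `|error w| <=
    perturbation_modulus (C * (4%:R / cG)) (M / cG) * delta / (c * (cG * c)).
Proof.
move=> [_ [v1 [v2 [_ db]]]] q1 q2 q3 q4 l1 l2 l3 l4.
have uS := design_bounds_unit db.
have s2b : c <= s2 w <= C.
  have vf : (\int[mu w]_y (y ^+ 2)%:E)%E \is a fin_num.
    by rewrite fin_numE; apply/andP; split; [apply: contraTneq v1 => ->|apply: contraTneq v2 => ->].
  by apply/andP; split; rewrite -lee_fin fineK.
move: db => [[_ t1] [[t2 t3] [[t4 _] [[s0 s1] _]]]].
apply: (@ratio_bound R n k (Xt w) (Gam w) alpha beta (cur w) (lag w) (s2 w) c C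
  (cG * c) (4%:R / cG) (M / cG) delta) => //.
- by rewrite mulr_gt0.
- by rewrite t1.
- by rewrite s0.
- by rewrite (ltW delta0).
- by rewrite dotC.
- by rewrite dotC.
Qed.

Lemma measurable_ratio : measurable_fun [set: Om]
  (fun w => sigma_hat (Xt w) (model_X (Xt w) (eps w) alpha)
     (model_y (Xt w) (eps w) alpha beta) (Gam w) / s2 w).
Proof.
have mX : mx_measurable (Xt : Om -> 'M[R]_(n, k)) by exact: HX.
have mQ : mx_measurable (Q : Om -> 'M[R]_n).
  by move=> i j; exact: (measurable_from_design (mx_measurable_Q i j)).
have ml := mx_measurable_lag; have mc := mx_measurable_cur.
have mX1 : mx_measurable (fun w : Om => model_X (Xt w) (eps w) alpha).
  apply: mx_measurableD; first exact: mX.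
  by apply: mx_measurable_mul; [exact: ml|exact: mx_measurable_cst].
have my : mx_measurable (fun w : Om => model_y (Xt w) (eps w) alpha beta).
  apply: mx_measurableD; last exact: mc.
  by apply: mx_measurable_mul; [exact: mX1|exact: mx_measurable_cst].
have ms2 : measurable_fun [set: Om] (s2 : Om -> R).
  apply: (@measurable_from_design s2); apply: measurableT_comp => //.
  by apply: measurable_mu_integral; exact: measurable_funX.
have mA : mx_measurable (A : Om -> 'M[R]_n).
  exact: mx_measurable_Qresidual.
have mT : measurable_fun [set: Om] (fun w => TmK (Xt w) (Gam w)).
  exact: (measurable_trace mA).
apply: measurable_funM; last exact: measurable_funV.
apply: measurable_funM; last exact: measurable_funV.
have m1 : mx_measurable (fun w : Om => (model_y (Xt w) (eps w) alpha beta)^T *m Q w *m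
   residual_maker (model_X (Xt w) (eps w) alpha) (Q w) *m model_y (Xt w) (eps w) alpha beta).
  apply: mx_measurable_mul => //; apply: mx_measurable_mul.
    by apply: mx_measurable_mul => //; exact: mx_measurable_tr.
  exact: mx_measurable_residual_maker.
exact: m1.
Qed.

Lemma measurable_error : measurable_fun [set: Om] error.
Proof.
have mX : mx_measurable (Xt : Om -> 'M[R]_(n, k)) by exact: HX.
have mQ : mx_measurable (Q : Om -> 'M[R]_n).
  by move=> i j; exact: (measurable_from_design (mx_measurable_Q i j)).
have ms2 : measurable_fun [set: Om] (s2 : Om -> R).
  apply: (@measurable_from_design s2); apply: measurableT_comp => //.
  by apply: measurable_mu_integral; exact: measurable_funX.
have mA : mx_measurable (A : Om -> 'M[R]_n).
  exact: mx_measurable_Qresidual.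
have mT : measurable_fun [set: Om] (fun w => TmK (Xt w) (Gam w)).
  exact: (measurable_trace mA).
apply: measurable_funB; first exact: measurable_ratio.
apply: measurable_funB; first exact: measurable_cst.
apply: measurable_funM; last first.
  apply: measurable_trace.
  have m1 : mx_measurable (fun w : Om => lagD R n *m Q w *m residual_maker (Xt w) (Q w)).
    apply: mx_measurable_mul; last exact: mx_measurable_residual_maker.
    by apply: mx_measurable_mul => //; exact: mx_measurable_cst.
  exact: m1.
apply: measurable_funM; last first.
  apply: measurable_trace.
  have m1 : mx_measurable (fun w : Om => (lagD R n)^T *m Q w *m residual_maker (Xt w) (Q w)).
    apply: mx_measurable_mul; last exact: mx_measurable_residual_maker.
    by apply: mx_measurable_mul => //; exact: mx_measurable_cst.
  exact: m1.
apply: measurable_funM; last exact: measurable_funV.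
apply: measurable_funM => //.
have m1 : mx_measurable (fun w : Om => alpha^T *m
   invmx (gram (Xt w) (Q w) + (s2 w * TmK (Xt w) (Gam w)) *: (alpha *m alpha^T)) *m alpha).
  apply: mx_measurable_mul; last exact: mx_measurable_cst.
  apply: mx_measurable_mul; first exact: mx_measurable_cst.
  apply: mx_measurable_inv; apply: mx_measurableD; first exact: mx_measurable_gram.
  by apply: mx_measurableZ; [exact: measurable_funM|exact: mx_measurable_cst].
exact: m1.
Qed.

(** On the regular event the error can exceed t only if one of eight forms is off target: four
    quadratic ones, and h and g each paired with the current and with the lagged errors. The union
    bound gives the factor 4 for either kind. *)
Lemma error_tail (t : R) :
  perturbation_modulus (C * (4%:R / cG)) (M / cG) * delta / (c * (cG * c)) <= t ->
  (P [set w | (t < `|error w|)%R] <= P [set w | (M < `|kappa w|)%R] +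
    (4%:R * (quadratic_tail + linear_tail) / delta ^+ 2 / n%:R)%:E)%E.
Proof.
move=> ht.
have mg : forall w, regular_event w -> dot (g w) (g w) <= 4%:R * M / cG ^+ 2 / n%:R.
  by move=> w [_ [_ [_ [_ [_ [_ [_ [_ []]]]]]]]].
have mh : forall w, regular_event w -> dot (h w) (h w) <= 4%:R * M / cG ^+ 2 / n%:R.
  by move=> w [_ [_ [_ [_ [_ [_ [_ [_ []]]]]]]]].
have mmg := mx_measurable_loading alpha mx_measurable_Xt mx_measurable_Q.
have mmh := mx_measurable_loading alpha mx_measurable_Xt (mx_measurable_tr mx_measurable_Q).
have ic := @current_inj n; have il := @lagged_inj n.
have bad := event_leU (quadratic_event ic ic) (event_leU (quadratic_event il il)
  (event_leU (quadratic_event il ic) (event_leU (quadratic_event ic il)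
  (event_leU (linear_event ic mmh mh) (event_leU (linear_event il mmh mh)
  (event_leU (linear_event ic mmg mg) (linear_event il mmg mg))))))).
set B := (X in event_le P X _) in bad.
have [mB PB] := bad.
have mE : measurable (~` (toG @^-1` regular_event)).
  apply: measurableC; rewrite -[X in measurable X]setTI.
  by apply: measurable_toG => //; exact: measurable_regular_event.
have mt : measurable [set w | (t < `|error w|)%R].
  by apply: measurable_cst_lt; apply: measurableT_comp => //; exact: measurable_error.
apply: (@le_trans _ _ (P (~` (toG @^-1` regular_event) `|` B))).
  apply: le_measure; rewrite ?inE//; first exact: measurableU.
  move=> w tw; have [Ew|nE] := pselect (regular_event w); last by left.
  right; apply: contrapT => nB; move: tw; apply/negP; rewrite -leNgt.
  apply: le_trans ht; move: nB; rewrite /B => /not_orP[b1 /not_orP[b2 /not_orP[b3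
    /not_orP[b4 /not_orP[b5 /not_orP[b6 /not_orP[b7 b8]]]]]]].
  have out (Z : Om -> R) (r : R) : ~ (toG @^-1` regular_event `&` [set w | (r < `|Z w|)%R]) w ->
      `|Z w| <= r.
    by move=> nZ; rewrite leNgt; apply/negP => hZ; apply: nZ.
  move: b1 b2 b3 b4 b5 b6 b7 b8 => /out b1 /out b2 /out b3 /out b4 /out b5 /out b6 /out b7 /out b8.
  rewrite (sum_diag_trace _ ic) in b1; rewrite (sum_diag_trace _ il) in b2.
  rewrite sum_lagged_current in b3; rewrite sum_current_lagged in b4.
  exact: error_le.
apply: le_trans (measureU2 _ mE mB) _.
apply: leeD; first exact: regular_event_tail.
apply: le_trans PB _; rewrite lee_fin le_eqVlt; apply/orP; left; apply/eqP.
by ring.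
Qed.

End FixedSample.

(** * Passage to the limit *)

Theorem theorem4 (R : realType) (c C cG : R)
  (hc : 0 < c < 1) (hC : 0 < C) (hcG : 0 < cG < 1)
  (d : nat -> measure_display) (Omega : forall T, measurableType (d T))
  (P : forall T, probability (Omega T) R)
  (K : nat -> nat)
  (Xt : forall T, Omega T -> 'M[R]_(T, K T))
  (eps : forall T, Omega T -> 'I_T.+1 -> R)
  (mu : forall T, Omega T -> probability R R)
  (alpha r beta : forall T, 'cV[R]_(K T))
  (Gam : forall T, Omega T -> 'M[R]_T)
  (* Assumption 1 (i) *)
  (HXmeas : forall T i j, measurable_fun setT (fun w => Xt T w i j))
  (Hrank : forall T, {ae P T, forall w, \rank (Xt T w) = K T})
  (* Assumption 1 (ii) *)
  (Hemeas : forall T i, measurable_fun setT (fun w => eps T w i))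
  (Hiid : forall T, cond_iid (P T) (sigma_gen (Xt T)) (fun i w => eps T w i) (mu T))
  (Hmean : forall T, {ae P T, forall w, (\int[mu T w]_y y%:E = 0)%E})
  (Hvar : forall T, {ae P T, forall w,
            (c%:E < \int[mu T w]_y (y ^+ 2)%:E < C%:E)%E})
  (H4 : forall T, {ae P T, forall w, (\int[mu T w]_y (y ^+ 4)%:E < C%:E)%E})
  (* Assumption 1 (iii) *)
  (Halpha : Op1 P (fun T w =>
     ((alpha T)^T *m invmx ((T%:R)^-1 *: ((Xt T w)^T *m Xt T w)) *m alpha T) 0 0))
  (Hr : Op1 P (fun T w =>
     ((r T)^T *m invmx ((T%:R)^-1 *: ((Xt T w)^T *m Xt T w)) *m r T) 0 0))
  (* Assumption 1 (iv) *)
  (HK : forall T, (K T)%:R / T%:R < 1 - c)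
  (* Gamma measurable w.r.t. tilde X with operator norm < 1 - cG *)
  (HGmeas : forall T i j, measurable_wrt (sigma_gen (Xt T)) (fun w => Gam T w i j))
  (HGnorm : forall T, {ae P T, forall w, opnorm (Gam T w) < 1 - cG}) :
  op1 P (fun T w =>
     sigma_hat (Xt T w) (model_X (Xt T w) (eps T w) (alpha T))
               (model_y (Xt T w) (eps T w) (alpha T) (beta T)) (Gam T w)
       / cond_var (mu T w)
     - rhs_limit (Xt T w) (Gam T w) (alpha T) (cond_var (mu T w)))
  /\
  ((forall T, {ae P T, forall w,
       \tr ((lagD R T)^T *m (1%:M - Gam T w) *m MG (Xt T w) (Gam T w)) = 0}) ->
   op1 P (fun T w =>
     sigma_hat (Xt T w) (model_X (Xt T w) (eps T w) (alpha T))
               (model_y (Xt T w) (eps T w) (alpha T) (beta T)) (Gam T w)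
       / cond_var (mu T w) - 1)).
Proof.
have [c0 c1] := andP hc; have [cG0 cG1] := andP hcG.
set error := (X in op1 P X /\ _).
have err : op1 P error.
  move=> t delta0 t0 d0.
  have d20 : 0 < delta0 / 2%:R by rewrite divr_gt0.
  have [M [N1 HM]] := Halpha _ d20.
  (* The level supplied by the O_p(1) hypothesis need not be positive; enlarging it only shrinks the
     tail. *)
  pose M' := `|M| + 1.
  have M'0 : 0 < M' by rewrite ltr_wpDl.
  have MM' : M <= M' by rewrite (le_trans (ler_norm _))// lerDl.
  pose L := `|perturbation_modulus (C * (4%:R / cG)) (M' / cG)| + 1.
  have L0 : 0 < L by rewrite ltr_wpDl.
  have w0 : 0 < c * (cG * c) by rewrite !mulr_gt0.
  have p0 : 0 < 3%:R + M' / cG by rewrite addr_gt0// divr_gt0.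
  (* The three entries make delta at most 1, keep the determinant [Delta] above 1/2, and bring the
     perturbation bound below t. L stands in for the modulus as a positive divisor. *)
  pose delta := Num.min 1 (Num.min (1 / 2%:R / (3%:R + M' / cG)) (t * (c * (cG * c)) / L)).
  have delta0' : 0 < delta.
    by rewrite !lt_min ltr01 !divr_gt0 ?mulr_gt0.
  have delta1 : delta <= 1 by rewrite ge_min lexx.
  have delta_half : (3%:R + M' / cG) * delta <= 1 / 2%:R.
    by rewrite mulrC -ler_pdivlMr// /delta !ge_min lexx /= orbT.
  have deltat : perturbation_modulus (C * (4%:R / cG)) (M' / cG) * delta / (c * (cG * c)) <= t.
    rewrite ler_pdivrMr//.
    apply: (@le_trans _ _ (L * delta)).
      by apply: ler_wpM2r; [exact: ltW|rewrite (le_trans (ler_norm _))// lerDl].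
    by rewrite mulrC -ler_pdivlMr// /delta !ge_min lexx !orbT.
  pose Kc := 4%:R * (quadratic_tail C cG + linear_tail C cG M') / delta ^+ 2.
  (* From N2 on the Chebyshev terms, Kc / T in total, are below half of the allowed probability; the
     other half is the tail of kappa. *)
  pose N2 := Num.Def.archi_bound (`|Kc| * 2%:R / delta0).
  exists (maxn (maxn N1 N2) 1) => T; rewrite !geq_max => /andP[/andP[N1T N2T] T0].
  have TR : 0 < T%:R :> R by rewrite ltr0n.
  have tail := error_tail (alpha T) (beta T) T0 c0 hC cG0 (HXmeas T) (Hrank T) (Hemeas T)
    (Hiid T) (Hmean T) (Hvar T) (H4 T) (HK T) (HGmeas T) (HGnorm T) M'0 delta0' delta1
    delta_half deltat.
  apply: le_lt_trans tail _.
  have -> : delta0%:E = ((delta0 / 2%:R)%:E + (delta0 / 2%:R)%:E)%E.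
    by rewrite -EFinD; congr EFin; field.
  apply: lteD.
    apply: le_lt_trans (HM _ N1T); apply: le_measure; rewrite ?inE.
    - apply: measurable_cst_lt; apply: measurableT_comp => //.
      exact: (measurable_kappa (alpha T) (HXmeas T)).
    - apply: measurable_cst_lt; apply: measurableT_comp => //.
      exact: (measurable_kappa (alpha T) (HXmeas T)).
    - by move=> w /=; exact: le_lt_trans.
  rewrite lte_fin -/Kc ltr_pdivrMr// -ltr_pdivrMl; last exact: d20.
  apply: (@lt_le_trans _ _ N2%:R); last by rewrite ler_nat.
  apply: (@le_lt_trans _ _ (`|Kc| * 2%:R / delta0)).
    rewrite invf_div mulrC mulrA; apply: ler_wpM2r; first by rewrite invr_ge0 ltW.
    by apply: ler_wpM2r => //; exact: ler_norm.
  by apply: archi_boundP; rewrite !mulr_ge0// ?invr_ge0 ltW.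
(* Almost surely the correction term is 0 and the limit formula equals 1, so the two deviation
   events differ by a null set. *)
split=> // tr0 t delta0 t0 d0.
have [N HN] := err _ _ t0 d0; exists N => T NT.
apply: le_lt_trans (HN _ NT); apply: ae_le_measure.
- apply: measurable_cst_lt; apply: measurableT_comp => //.
  apply: measurable_funB; last exact: measurable_cst.
  exact: (measurable_ratio (alpha T) (beta T) (HXmeas T) (Hemeas T) (Hiid T) (HGmeas T)).
- apply: measurable_cst_lt; apply: measurableT_comp => //.
  exact: (measurable_error (alpha T) (beta T) (HXmeas T) (Hemeas T) (Hiid T) (HGmeas T)).
apply: (@filterS _ (almost_everywhere (P T)) _ _ _ _ (tr0 T)) => w trw.
by rewrite /= /error /rhs_limit trw mulr0 mul0r subr0.
Qed.
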